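(* Suppose there exist $k\in\{1,2,3,\ldots\}$ and a set $A$ of Boolean formulas such that: (a) $A\in\mathrm{P}$ and $A\cap\mathrm{SAT}$ is $\mathrm{NP}$-complete; (b) each formula $G\in A$ has a strong backdoor $S$ with respect to the unit propagation subsolver with $\|S\|\leq k$; and (c) there is a polynomial-time algorithm that, given $G\in A$, finds a strong backdoor of $G$ with respect to the unit propagation subsolver having the property in (b). Then $\mathrm{P}=\mathrm{NP}$.
   Context: Formulas are encoded as strings over a finite alphabet $\Sigma$; $\mathrm{SAT}$ is the set of satisfiable Boolean formulas. For a formula $F$, $V(F)$ is its set of variables, and $\|X\|$ is the cardinality of a finite set $X$. A CNF formula is viewed as a set of clauses, each clause a set of literals; it is satisfiable iff some assignment makes at least one literal of every clause true. The empty CNF formula is trivially True, and a CNF formula containing the empty clause is trivially False. A partial assignment $a_S$ assigns truth values to the variables of a set $S\subseteq V(F)$; $F[a_S]$ denotes the simplified formula: for each variable $x$ set to True (resp. False), remove every clause containing the literal $x$ (resp. $\overline{x}$) and delete the literal $\overline{x}$ (resp. $x$) from the remaining clauses. A subsolver is a polynomial-time algorithm $A$ such that for each input formula $F$: (i) $A$ either rejects $F$ or determines $F$ (returns a satisfying assignment if $F$ is satisfiable, and proclaims unsatisfiability if $F$ is unsatisfiable); (ii) $A$ determines $F$ whenever $F$ is trivially True or trivially False; (iii) if $A$ determines $F$ then for each variable $x$ and value $v$, $A$ determines $F[v/x]$. The unit propagation subsolver works as follows: while the current formula is neither trivially True nor trivially False and contains a unit clause (a clause with exactly one literal), it takes the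 unit clause whose encoding is lexicographically least, sets its literal to True, and simplifies; if it reaches a trivially True formula it returns the satisfying assignment built, if it reaches a formula containing the empty clause it proclaims unsatisfiability, and otherwise it rejects. A strong backdoor of a formula $F$ for a subsolver $A$ is a nonempty set $S\subseteq V(F)$ such that for every partial assignment $a_S$, $A$ determines $F[a_S]$. *)

(* Defs.v *)
From mathcomp Require Import all_boot.
Set Implicit Arguments. Unset Strict Implicit. Unset Printing Implicit Defensive.

Definition word := seq bool.
Definition language := word -> Prop.

(* Machine model: deterministic one-tape Turing machines with a finite  *)
(* state set and a finite tape alphabet containing {0,1} and a blank.   *)
(* The tape is two-way infinite.                                        *)
Inductive move := MLeft | MRight | MStay.

Record TM := mkTM {
  tm_Q : finType;
  tm_G : finType;
  tm_blank : tm_G;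
  tm_sym : bool -> tm_G;
  tm_bit : tm_G -> option bool;
  tm_bitK : forall b, tm_bit (tm_sym b) = Some b;
  tm_bit_blank : tm_bit tm_blank = None;
  tm_q0 : tm_Q;
  tm_halt : tm_Q -> bool;
  tm_acc : tm_Q -> bool;
  tm_delta : tm_Q -> tm_G -> tm_Q * tm_G * move }.

(* configuration: state, tape left of the head (nearest first), tape from
   the head rightwards (head cell first); missing cells are blank *)
Definition config (M : TM) := (tm_Q M * seq (tm_G M) * seq (tm_G M))%type.

Definition tm_step (M : TM) (c : config M) : config M :=
  let: (q, l, r) := c in
  if tm_halt q then c else
  let: (q', b, m) := tm_delta q (head (tm_blank M) r) in
  let r' := behead r in
  match m with
  | MLeft => (q', behead l, head (tm_blank M) l :: b :: r')
  | MRight => (q', b :: l, r')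
  | MStay => (q', l, b :: r')
  end.

Definition tm_init (M : TM) (x : word) : config M :=
  (tm_q0 M, [::], map (@tm_sym M) x).

Definition tm_run (M : TM) (t : nat) (x : word) : config M :=
  iter t (@tm_step M) (tm_init M x).

Fixpoint read_bits (G : Type) (bit : G -> option bool) (r : seq G) : word :=
  match r with
  | [::] => [::]
  | g :: r' => match bit g with Some b => b :: read_bits bit r' | None => [::] end
  end.

Definition tm_output (M : TM) (c : config M) : word := read_bits (@tm_bit M) c.2.

Definition tm_halts_within (M : TM) (t : nat) (x : word) : bool :=
  tm_halt (tm_run M t x).1.1.

Definition tm_accepts_within (M : TM) (t : nat) (x : word) : bool :=
  tm_acc (tm_run M t x).1.1.

Definition poly_bound (c n : nat) : nat := c * n ^ c + c.

Definition in_P (L : language) : Prop :=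
  exists (M : TM) (c : nat), forall x : word,
    tm_halts_within M (poly_bound c (size x)) x /\
    (tm_accepts_within M (poly_bound c (size x)) x <-> L x).

Definition poly_time_computable (f : word -> word) : Prop :=
  exists (M : TM) (c : nat), forall x : word,
    tm_halts_within M (poly_bound c (size x)) x /\
    tm_output (tm_run M (poly_bound c (size x)) x) = f x.

Definition pair_word (x w : word) : word :=
  flatten (map (fun b => [:: b; b]) x) ++ [:: false; true] ++ w.

Definition in_NP (L : language) : Prop :=
  exists (V : language) (c : nat), in_P V /\
    forall x : word, L x <-> exists w : word,
      size w <= poly_bound c (size x) /\ V (pair_word x w).

Definition NP_hard (B : language) : Prop :=
  forall L : language, in_NP L ->
    exists f : word -> word, poly_time_computable f /\ forall x, L x <-> B (f x).

Definition NP_complete (B : language) : Prop := in_NP B /\ NP_hard B.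

Definition P_eq_NP : Prop := forall L : language, in_P L <-> in_NP L.

(* CNF formulas.  A literal is (variable, polarity): (v, true) is x_v,  *)
(* (v, false) is its negation.  A clause / CNF formula is a list that   *)
(* is always read as the SET of its elements.                           *)
Definition lit := (nat * bool)%type.
Definition clause := seq lit.
Definition cnf := seq clause.

(* binary representation (little endian, no trailing zeros) *)
Fixpoint bin_aux (k n : nat) : seq bool :=
  match k with
  | 0 => [::]
  | k'.+1 => if n == 0 then [::] else odd n :: bin_aux k' n./2
  end.
Definition bin (n : nat) : seq bool := bin_aux n n.

Definition tok_digit (b : bool) : word := [:: false; b].
Definition tok_endlit : word := [:: true; false].
Definition tok_endcl : word := [:: true; true].

Definition encode_lit (l : lit) : word :=
  tok_digit l.2 ++ flatten (map tok_digit (bin l.1)) ++ tok_endlit.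
Definition encode_clause (c : clause) : word :=
  flatten (map encode_lit c) ++ tok_endcl.
Definition encode_cnf (F : cnf) : word := flatten (map encode_clause F).

Definition encode_vars (S : seq nat) : word :=
  flatten (map (fun v => flatten (map tok_digit (bin v)) ++ tok_endlit) S).

Definition lit_true (a : nat -> bool) (l : lit) : bool := a l.1 == l.2.
Definition satisfies (a : nat -> bool) (F : cnf) : bool :=
  all (fun c => has (lit_true a) c) F.
Definition satisfiable (F : cnf) : Prop := exists a, satisfies a F.

Definition SAT : language := fun x => exists F : cnf, x = encode_cnf F /\ satisfiable F.

Definition vars (F : cnf) : seq nat := flatten (map (map fst) F).

Definition trivially_true (F : cnf) : bool := F == [::].
Definition trivially_false (F : cnf) : bool := [::] \in F.

Definition assign_lit (l : lit) (F : cnf) : cnf :=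
  [seq [seq m <- c | m != (l.1, ~~ l.2)] | c <- F & l \notin c].

Definition restrict (F : cnf) (S : seq nat) (a : nat -> bool) : cnf :=
  [seq [seq m <- c | ~~ ((m.1 \in S) && ~~ lit_true a m)]
     | c <- F & ~~ has (fun m => (m.1 \in S) && lit_true a m) c].

Fixpoint lex_lt (s t : word) : bool :=
  match s, t with
  | [::], [::] => false
  | [::], _ :: _ => true
  | _ :: _, [::] => false
  | b :: s', b' :: t' => (~~ b && b') || ((b == b') && lex_lt s' t')
  end.

Definition unit_lits (F : cnf) : seq lit :=
  [seq head (0, true) c | c <- F & size (undup c) == 1].

Definition least_unit (F : cnf) : option lit :=
  foldr (fun l acc => match acc with
                      | None => Some l
                      | Some m => if lex_lt (encode_clause [:: l]) (encode_clause [:: m])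
                                  then Some l else Some m
                      end) None (unit_lits F).

Inductive up_result := UP_sat of seq lit | UP_unsat | UP_reject.

(* each iteration removes at least the chosen unit clause, so the fuel
   (size F).+1 is never exhausted *)
Fixpoint up_loop (fuel : nat) (F : cnf) (acc : seq lit) : up_result :=
  if trivially_true F then UP_sat acc else
  if trivially_false F then UP_unsat else
  match fuel with
  | 0 => UP_reject
  | fuel'.+1 =>
    match least_unit F with
    | None => UP_reject
    | Some l => up_loop fuel' (assign_lit l F) (l :: acc)
    end
  end.

Definition unit_prop (F : cnf) : up_result := up_loop (size F).+1 F [::].

(* a partial assignment, given as a list of literals set to True, is a
   satisfying assignment of F *)
Definition psat (s : seq lit) (F : cnf) : Prop :=
  (forall v, ~ ((v, true) \in s /\ (v, false) \in s)) /\
  all (fun c => has (fun l => l \in s) c) F.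

Definition up_determines (F : cnf) : Prop :=
  match unit_prop F with
  | UP_sat s => psat s F
  | UP_unsat => ~ satisfiable F
  | UP_reject => False
  end.

(* strong backdoor w.r.t. unit propagation; the set S is given as a list,
   partial assignments a_S as all functions restricted to S *)
Definition strong_backdoor_UP (F : cnf) (S : seq nat) : Prop :=
  S != [::] /\ {subset S <= vars F} /\
  forall a : nat -> bool, up_determines (restrict F S a).

Definition card_vars (S : seq nat) : nat := size (undup S).

(* Main.v *)
Require Import Defs.
From HB Require Import structures.
From mathcomp Require Import all_boot zify.
Set Implicit Arguments. Unset Strict Implicit. Unset Printing Implicit Defensive.

(** A strong backdoor [S] of size at most [k] makes satisfiability of [F]
    equivalent to: some assignment of [S] is not refuted by unit propagation.
    Hence [F] is unsatisfiable iff it is refuted by "[k]-fold lookahead", where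
    0-fold lookahead is unit propagation and (j+1)-fold lookahead may branch on
    one literal: if [F] is satisfiable nothing sound refutes it, and otherwise
    branching on the variables of [S] does. The lookahead takes polynomial time
    for fixed [k] and so decides membership in SAT for the formulas of [A].

    Programs on five stacks of bits are simulated by a one-tape machine whose
    tape carries the stacks as tracks. A function on tree-encoded data is polynomial-time ([fp]) if such a program
    computes it in polynomially many steps. This class is closed under
    composition, pairing, branching and folds with polynomially bounded
    accumulators, and contains the bounded simulation of any Turing machine. *)

(** * Polynomial bounds *)

(** Unit propagation as defined rewrites the formula and selects a least unit clause at every step.
    The refutation procedure keeps [F] fixed instead and grows a set of derived literals, firing all
    unit clauses at once. This operator is monotone, so the selection order disappears and one round
    derives at least what one sequential step does. Only the answer [UP_unsat] has to be matched: on
    an assignment of a backdoor the other possible answer exhibits a satisfying assignment. Literals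
    range over an arbitrary type with a negation. Correctness is argued on pairs of a variable and a
    polarity, while the program runs on the digit strings found in the encoding; an injective
    renaming that commutes with negation transfers the verdict, and no arithmetic on variables is
    ever programmed. Serialised trees form a self-delimiting prefix code. A program can therefore
    split its argument off stack A whatever lies below, which is what lets programs be composed. *)

(** The base [n + 2] is at least 2, so powers grow with the exponent and a single exponent absorbs
    constants, sums and products. *)
Definition polyb (h : nat -> nat) := exists c, forall n, h n <= (n + 2) ^ c.

Lemma leq_exp2D n c d : c <= d -> (n + 2) ^ c <= (n + 2) ^ d.
Proof. by move=> cd; rewrite leq_pexp2l // addn2. Qed.

Lemma polyb_const k : polyb (fun=> k).
Proof.
exists k => n; apply: leq_trans (ltnW (ltn_expl k (isT : 1 < 2))) _.
by case: k => // k; rewrite leq_exp2r ?leq_addl.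
Qed.

Lemma polyb_id : polyb id.
Proof. by exists 1 => n; rewrite expn1 leq_addr. Qed.

Lemma polyb_add h g : polyb h -> polyb g -> polyb (fun n => h n + g n).
Proof.
move=> [c hc] [d gd]; exists (maxn c d).+1 => n.
apply: leq_trans (leq_add (hc n) (gd n)) _.
have := leq_exp2D n (leq_maxl c d); have := leq_exp2D n (leq_maxr c d).
rewrite expnS; nia.
Qed.

Lemma polyb_mul h g : polyb h -> polyb g -> polyb (fun n => h n * g n).
Proof.
by move=> [c hc] [d gd]; exists (c + d) => n; rewrite expnD leq_mul.
Qed.

Lemma polyb_exp h k : polyb h -> polyb (fun n => h n ^ k).
Proof.
move=> [c hc]; exists (c * k) => n; rewrite expnM.
by case: k => // k; rewrite leq_exp2r.
Qed.

Lemma poly_bound_polyb h : polyb h -> exists c, forall n, h n <= poly_bound c n.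
Proof.
(* For n > 0, n + 2 is at most 3n, which gives the factor [3 ^ c]. The summand [c] makes the
   exponent large enough, and the additive constant of [poly_bound] covers n = 0. *)
move=> [c hc]; exists (3 ^ c + c) => n; apply: leq_trans (hc n) _.
rewrite /poly_bound; case: n => [|n].
  apply: leq_trans (leq_addl _ _); apply: leq_trans (leq_addr _ _).
  by case: c {hc} => // c; rewrite leq_exp2r.
apply: leq_trans (leq_addr _ _).
apply: (@leq_trans (3 ^ c * n.+1 ^ c)).
  by rewrite -expnMn; case: c {hc} => // c; rewrite leq_exp2r //; lia.
by rewrite leq_mul ?leq_addr // leq_pexp2l // leq_addl.
Qed.

(** * Stack programs *)

Inductive idx := iA | iB | iC | iD | iE.
Definition idx_nat (i : idx) : nat :=
  match i with iA => 0 | iB => 1 | iC => 2 | iD => 3 | iE => 4 end.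
Definition nat_idx (k : nat) : idx :=
  match k with 0 => iA | 1 => iB | 2 => iC | 3 => iD | _ => iE end.
Lemma idx_natK : cancel idx_nat nat_idx. Proof. by case. Qed.
HB.instance Definition _ := Countable.copy idx (can_type idx_natK).
Lemma idx_enumP : Finite.axiom [:: iA; iB; iC; iD; iE]. Proof. by case. Qed.
HB.instance Definition _ := isFinite.Build idx idx_enumP.

Record store := St { sA : seq bool; sB : seq bool; sC : seq bool;
                     sD : seq bool; sE : seq bool }.
Definition get (s : store) (i : idx) : seq bool :=
  match i with iA => sA s | iB => sB s | iC => sC s | iD => sD s | iE => sE s end.
Definition set (s : store) (i : idx) (v : seq bool) : store :=
  let: St a b c d e := s in
  match i with
  | iA => St v b c d e | iB => St a v c d e | iC => St a b v d e
  | iD => St a b c v e | iE => St a b c d v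
  end.
Lemma get_set s i v j : get (set s i v) j = if j == i then v else get s j.
Proof.
case: eqVneq => [->|]; first by case: s i => a b c d e [].
by case: s => a b c d e; case: i; case: j; rewrite ?eqxx.
Qed.

(* [While i pF pT] pops stack [i] and, unless it was empty, runs the branch
   selected by the popped bit and starts again. *)
Inductive prog :=
| Skip
| Push of idx & bool
| Seq of prog & prog
| Pop of idx & prog & prog & prog
| While of idx & prog & prog.

Inductive exec : prog -> store -> store -> nat -> Prop :=
| exec_skip s : exec Skip s s 0
| exec_push i b s : exec (Push i b) s (set s i (b :: get s i)) 1
| exec_seq p q s1 s2 s3 m n :
    exec p s1 s2 m -> exec q s2 s3 n -> exec (Seq p q) s1 s3 (m + n)
| exec_popN i pN pF pT s s' n :
    get s i = [::] -> exec pN s s' n -> exec (Pop i pN pF pT) s s' n.+1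
| exec_popC i pN pF pT s s' b r n :
    get s i = b :: r -> exec (if b then pT else pF) (set s i r) s' n ->
    exec (Pop i pN pF pT) s s' n.+1
| exec_whileN i pF pT s : get s i = [::] -> exec (While i pF pT) s s 1
| exec_whileC i pF pT s s1 s2 b r m n :
    get s i = b :: r -> exec (if b then pT else pF) (set s i r) s1 m ->
    exec (While i pF pT) s1 s2 n -> exec (While i pF pT) s s2 (m + n).+1.

Inductive instr (Q : Type) :=
| IPush of idx & bool & option Q
| IPop of idx & option Q & (bool -> option Q).
Arguments IPush {Q}. Arguments IPop {Q}.

Record code := Code { cQ : finType; centry : option cQ; cact : cQ -> instr cQ }.

Definition target (Q : Type) (a : instr Q) : idx :=
  match a with IPush i _ _ => i | IPop i _ _ => i end.

Definition imap (Q Q' : Type) (e : option Q -> option Q') (a : instr Q) : instr Q' :=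
  match a with
  | IPush i b o => IPush i b (e o)
  | IPop i o k => IPop i (e o) (e \o k)
  end.

Definition cstep (M : code) (q : cQ M) (s : store) : option (cQ M) * store :=
  match cact q with
  | IPush i b o => (o, set s i (b :: get s i))
  | IPop i o k => if get s i is b :: r then (k b, set s i r) else (o, s)
  end.

Inductive reach (M : code) : option (cQ M) -> store -> option (cQ M) -> store -> nat -> Prop :=
| reach0 o s : reach o s o s 0
| reachS q s o s' n : reach (cstep q s).1 (cstep q s).2 o s' n -> reach (Some q) s o s' n.+1.

Lemma reach_trans M (o1 o2 o3 : option (cQ M)) s1 s2 s3 m n :
  reach o1 s1 o2 s2 m -> reach o2 s2 o3 s3 n -> reach o1 s1 o3 s3 (m + n).
Proof.
by elim=> [//|q s o s' k _ IH] H; rewrite addSn; constructor; apply: IH.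
Qed.

(** [e None] is left free: it is the place where control goes when the embedded code exits, so the
    same notion serves for sequencing, branching and loops. *)
Definition embeds (M1 M : code) (e : option (cQ M1) -> option (cQ M)) : Prop :=
  forall q : cQ M1, exists2 q', e (Some q) = Some q' & cact q' = imap e (cact q).

Lemma reach_embeds M1 M (e : option (cQ M1) -> option (cQ M)) o s o' s' n :
  embeds e -> reach o s o' s' n -> reach (e o) s (e o') s' n.
Proof.
move=> He; elim=> {o s o' s' n} [o s|q s o s' n _ IH]; first by constructor.
have [q' eq' aq'] := He q; rewrite eq'; constructor.
move: IH; rewrite /cstep aq'; case: (cact q) => [i b o1|i o1 k] //=.
by case: (get s i).
Qed.

Definition oext (A B : Type) (f : A -> B) (d : option B) (o : option A) : option B :=
  if o is Some a then Some (f a) else d.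

Definition seq_code (M N : code) : code :=
  let eN := oext (@inr (cQ M) (cQ N)) None in
  let eM := oext inl (eN (centry N)) in
  @Code (cQ M + cQ N)%type (eM (centry M))
    (fun q => match q with
       | inl q => imap eM (cact q)
       | inr q => imap eN (cact q) end).

Definition branch_state (MN MF MT : code) : finType :=
  option (cQ MN + (cQ MF + cQ MT))%type.

Definition pop_code (i : idx) (MN MF MT : code) : code :=
  let Q := branch_state MN MF MT in
  let eN := oext (fun q => Some (inl q) : Q) None in
  let eF := oext (fun q => Some (inr (inl q)) : Q) None in
  let eT := oext (fun q => Some (inr (inr q)) : Q) None in
  @Code Q (Some None)
    (fun q => match q with
       | None => IPop i (eN (centry MN))
                   (fun b => if b then eT (centry MT) else eF (centry MF))
       | Some (inl q) => imap eN (cact q)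
       | Some (inr (inl q)) => imap eF (cact q)
       | Some (inr (inr q)) => imap eT (cact q)
       end).

(** Both bodies exit to [Some None], the state of the test, which closes the loop. *)
Definition while_code (i : idx) (MF MT : code) : code :=
  let Q : finType := option (cQ MF + cQ MT)%type in
  let eF := oext (fun q => Some (inl q) : Q) (Some None) in
  let eT := oext (fun q => Some (inr q) : Q) (Some None) in
  @Code Q (Some None)
    (fun q => match q with
       | None => IPop i None
                   (fun b => if b then eT (centry MT) else eF (centry MF))
       | Some (inl q) => imap eF (cact q)
       | Some (inr q) => imap eT (cact q)
       end).

Fixpoint compile (p : prog) : code :=
  match p with
  | Skip => @Code void None (fun q => match q with end)
  | Push i b => @Code unit (Some tt) (fun _ => IPush i b None)
  | Seq p q => seq_code (compile p) (compile q)
  | Pop i pN pF pT => pop_code i (compile pN) (compile pF) (compile pT)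
  | While i pF pT => while_code i (compile pF) (compile pT)
  end.

Lemma compileP p s s' n :
  exec p s s' n -> reach (centry (compile p)) s None s' n.
Proof.
elim=> {p s s' n} /=.
- by move=> s; constructor.
- by move=> i b s; do 2!constructor.
- move=> p q s1 s2 s3 m n _ IH1 _ IH2.
  apply: reach_trans (reach_embeds _ IH1) _; first by move=> x; exists (inl x).
  have /= := reach_embeds _ IH2.
  by move=> /(_ (seq_code (compile p) (compile q)) (oext inr None)); apply=> x; exists (inr x).
- move=> i pN pF pT s s' n si _ IH; constructor; rewrite /cstep /= si /=.
  have := reach_embeds _ IH.
  move=> /(_ (pop_code i (compile pN) (compile pF) (compile pT)) (oext (fun q => Some (inl q)) None)).
  by apply=> x; exists (Some (inl x)).
- move=> i pN pF pT s s' b r n si _ IH; constructor; rewrite /cstep /= si /=.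
  have := reach_embeds _ IH => /(_ (pop_code i (compile pN) (compile pF) (compile pT))).
  case: b {si} IH => IH.
    by move=> /(_ (oext (fun q => Some (inr (inr q))) None)); apply=> x; exists (Some (inr (inr x))).
  by move=> /(_ (oext (fun q => Some (inr (inl q))) None)); apply=> x; exists (Some (inr (inl x))).
- by move=> i pF pT s si; constructor; rewrite /cstep /= si; constructor.
- move=> i pF pT s s1 s2 b r m n si _ IH _ IH2; constructor; rewrite /cstep /= si /=.
  apply: reach_trans IH2.
  have := reach_embeds _ IH => /(_ (while_code i (compile pF) (compile pT))).
  case: b {si} IH => IH.
    by move=> /(_ (oext (fun q => Some (inr q)) (Some None))); apply=> x; exists (Some (inr x)).
  by move=> /(_ (oext (fun q => Some (inl q)) (Some None))); apply=> x; exists (Some (inl x)).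
Qed.

(** * Compilation to a one-tape Turing machine *)

(* The stacks lie side by side on the tracks of one tape, bottoms next to a
   marked origin cell; each stack instruction is a round trip of the head from
   the origin to the top of the stack concerned. *)
Section StackTM.
Variable M : code.

Definition cell : finType := (bool * {ffun idx -> option bool})%type.
Definition no_sym : {ffun idx -> option bool} := [ffun=> None].
Definition bcell : cell := (false, no_sym).
(** Input symbols occupy the track of stack B. Once the cell left of the input is marked as origin,
    the initial tape already represents a store, with the first input bit at the bottom of B. *)
Definition icell (b : bool) : cell := (false, [ffun i => if i == iB then Some b else None]).
Definition cell_bit (g : cell) : option bool :=
  if g.1 then None else g.2 iB.
Lemma icellK b : cell_bit (icell b) = Some b.
Proof. by rewrite /cell_bit /= ffunE eqxx. Qed.
Lemma bcellK : cell_bit bcell = None.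
Proof. by rewrite /cell_bit /= ffunE. Qed.

Definition put (g : cell) (i : idx) (x : option bool) : cell :=
  (g.1, [ffun j => if j == i then x else g.2 j]).

(** [TRest] walks left to the origin, [TScan] walks right to the first free cell of the track
    concerned, and [TTop] stands one cell left of it, on the top of the stack or on the origin if
    the stack is empty. *)
Inductive tstate := TInit | TMark | TRest of option (cQ M) | TScan of cQ M
                  | TTop of cQ M | TFin | TDone of bool.
Definition tstate_sum (t : tstate) :=
  match t with
  | TInit => inl None | TMark => inl (Some None) | TFin => inl (Some (Some None))
  | TDone b => inl (Some (Some (Some b)))
  | TRest o => inr (inl o) | TScan q => inr (inr (inl q)) | TTop q => inr (inr (inr q))
  end.
Definition sum_tstate (t : option (option (option bool)) + (option (cQ M) + (cQ M + cQ M))) :=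
  match t with
  | inl None => TInit | inl (Some None) => TMark | inl (Some (Some None)) => TFin
  | inl (Some (Some (Some b))) => TDone b
  | inr (inl o) => TRest o | inr (inr (inl q)) => TScan q | inr (inr (inr q)) => TTop q
  end.
Lemma tstate_sumK : cancel tstate_sum sum_tstate. Proof. by case. Qed.
HB.instance Definition _ := Finite.copy tstate (can_type tstate_sumK).

Definition tdelta (t : tstate) (g : cell) : tstate * cell * move :=
  match t with
  | TInit => (TMark, g, MLeft)
  | TMark => (TRest (centry M), (true, no_sym), MStay)
  | TRest o =>
    if g.1 then (if o is Some q then TScan q else TFin, g, MRight) else (t, g, MLeft)
  | TScan q =>
    match cact q with
    | IPush i b o => if g.2 i is Some _ then (t, g, MRight) else (TRest o, put g i (Some b), MLeft)
    | IPop i o k => if g.2 i is Some _ then (t, g, MRight) else (TTop q, g, MLeft)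
    end
  | TTop q =>
    match cact q with
    | IPush i b o => (t, g, MStay)
    | IPop i o k => if g.1 then (TRest o, g, MStay) else
        if g.2 i is Some b then (TRest (k b), put g i None, MLeft) else (t, g, MStay)
    end
  | TFin => (TDone (isSome (g.2 iA)), g, MStay)
  | TDone b => (t, g, MStay)
  end.

Definition stackTM : TM :=
  @mkTM tstate cell bcell icell cell_bit icellK bcellK TInit
    (fun t => if t is TDone _ then true else false)
    (fun t => if t is TDone b then b else false) tdelta.

(** Positions are counted from the origin; the tape to its left is left unconstrained. *)
Definition tape_at (f : nat -> cell) (p : nat) (l r : seq cell) : Prop :=
  (forall m, nth bcell r m = f (p + m)) /\
  (forall m, m < p -> nth bcell l m = f (p - m.+1)).

Definition tfupd (f : nat -> cell) (p : nat) (g : cell) : nat -> cell :=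
  fun j => if j == p then g else f j.

Lemma tape_at_ext f f' p l r : f =1 f' -> tape_at f p l r -> tape_at f' p l r.
Proof. by move=> ff [H1 H2]; split=> [m|m mp]; rewrite -ff; auto. Qed.

Lemma tape_head f p l r : tape_at f p l r -> head bcell r = f p.
Proof. by case=> H _; rewrite -nth0 H addn0. Qed.

Lemma nth_beheadE (T : Type) (x : T) s m : nth x (behead s) m = nth x s m.+1.
Proof. by case: s => //=; rewrite nth_nil. Qed.

Lemma tape_stay f p l r g : tape_at f p l r -> tape_at (tfupd f p g) p l (g :: behead r).
Proof.
move=> [H1 H2]; rewrite /tfupd; split=> [[|m]|m mp] /=.
- by rewrite addn0 eqxx.
- by rewrite nth_beheadE H1; case: eqP => //; lia.
- by rewrite H2 //; case: eqP => //; lia.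
Qed.

Lemma tape_right f p l r g : tape_at f p l r -> tape_at (tfupd f p g) p.+1 (g :: l) (behead r).
Proof.
move=> [H1 H2]; rewrite /tfupd; split=> [m|[|m] mp] /=.
- by rewrite nth_beheadE H1 addnS addSn; case: eqP => //; lia.
- by rewrite subn1 /= eqxx.
- by rewrite H2 // subSS; case: eqP => //; lia.
Qed.

Lemma tape_left f p l r g : tape_at f p.+1 l r ->
  tape_at (tfupd f p.+1 g) p (behead l) (head bcell l :: g :: behead r).
Proof.
move=> [H1 H2]; rewrite /tfupd; split=> [[|[|m]]|m mp] /=.
- by rewrite -nth0 H2 // addn0 subn1 /=; case: eqP => //; lia.
- by rewrite addn1 eqxx.
- by rewrite nth_beheadE H1 !addnS addSn; case: eqP => //; lia.
- rewrite nth_beheadE H2 // subSS; case: eqP => //; lia.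
Qed.

Definition store_tape (s : store) (j : nat) : cell :=
  if j is j'.+1 then (false, [ffun i => onth (rev (get s i)) j']) else (true, no_sym).

Definition conf_at (s : store) (t : tstate) (p : nat) (c : config stackTM) : Prop :=
  c.1.1 = t /\ tape_at (store_tape s) p c.1.2 c.2.

Definition tsteps s t p s' t' p' n : Prop :=
  forall c, conf_at s t p c -> conf_at s' t' p' (iter n (@tm_step stackTM) c).

Lemma tsteps0 s t p : tsteps s t p s t p 0. Proof. by []. Qed.

Lemma tsteps_trans s1 t1 p1 s2 t2 p2 s3 t3 p3 m n :
  tsteps s1 t1 p1 s2 t2 p2 m -> tsteps s2 t2 p2 s3 t3 p3 n ->
  tsteps s1 t1 p1 s3 t3 p3 (n + m).
Proof. by move=> H1 H2 c Hc; rewrite iterD; apply/H2/H1. Qed.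

Definition not_done (t : tstate) := if t is TDone _ then false else true.

Lemma tstep1 s t p t' g m s' p' : not_done t ->
  tdelta t (store_tape s p) = (t', g, m) ->
  tfupd (store_tape s) p g =1 store_tape s' ->
  match m with MLeft => p = p'.+1 | MRight => p' = p.+1 | MStay => p' = p end ->
  tsteps s t p s' t' p' 1.
Proof.
move=> nd dt ext pm [[q l] r] [/= -> T]; rewrite /tm_step /=.
have -> : (if t is TDone _ then true else false) = false by case: (t) nd.
rewrite (tape_head T) dt.
case: m dt pm => dt pm; rewrite ?pm in T ext *; split=> //=; apply: tape_at_ext ext _.
- exact: tape_left.
- exact: tape_right.
- exact: tape_stay.
Qed.

Lemma tfupd_same f p : tfupd f p (f p) =1 f.
Proof. by move=> j; rewrite /tfupd; case: eqP => [->|]. Qed.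

Lemma store_tapeS s j i : (store_tape s j.+1).2 i = onth (rev (get s i)) j.
Proof. by rewrite /= ffunE. Qed.

Lemma store_tape_full s i j : j < size (get s i) -> exists b, (store_tape s j.+1).2 i = Some b.
Proof.
move=> ji; rewrite store_tapeS.
have : (onth (rev (get s i)) j : bool) by rewrite onthTE size_rev.
by case: (onth _ _) => // b _; exists b.
Qed.

Lemma store_tape_top s i j : size (get s i) <= j -> (store_tape s j.+1).2 i = None.
Proof. by move=> ji; rewrite store_tapeS onth_default ?size_rev. Qed.

Lemma store_tape_pop s i b r : get s i = b :: r ->
  (store_tape s (size r).+1).2 i = Some b.
Proof.
by move=> si; rewrite store_tapeS si rev_cons -cats1 onth_cat size_rev ltnn subnn.
Qed.

Lemma tfupd_push s i b :
  tfupd (store_tape s) (size (get s i)).+1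
    (put (store_tape s (size (get s i)).+1) i (Some b))
  =1 store_tape (set s i (b :: get s i)).
Proof.
case=> [|j]; rewrite /tfupd ?eqSS; first by [].
case: eqVneq => [->|ji]; rewrite /store_tape /put /=; congr pair; apply/ffunP=> i';
  rewrite !ffunE get_set; case: eqVneq => // Ei; rewrite ?Ei.
  by rewrite rev_cons -cats1 onth_cat size_rev ltnn subnn.
rewrite rev_cons -cats1 onth_cat size_rev; case: ltnP => // sj.
by rewrite !onth_default ?size_rev //= subn_gt0 ltn_neqAle eq_sym ji.
Qed.

Lemma tfupd_pop s i b r : get s i = b :: r ->
  tfupd (store_tape s) (size r).+1 (put (store_tape s (size r).+1) i None)
  =1 store_tape (set s i r).
Proof.
move=> si; case=> [|j]; rewrite /tfupd ?eqSS; first by [].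
case: eqVneq => [->|ji]; rewrite /store_tape /put /=; congr pair; apply/ffunP=> i';
  rewrite !ffunE get_set; case: eqVneq => // Ei; rewrite ?Ei.
  by rewrite onth_default // size_rev.
rewrite si rev_cons -cats1 onth_cat size_rev; case: ltnP => // sj.
by rewrite !onth_default ?size_rev //= subn_gt0 ltn_neqAle eq_sym ji.
Qed.

Lemma tsteps_return s o p : tsteps s (TRest o) p s (TRest o) 0 p.
Proof.
elim: p => // p IH; rewrite -[X in tsteps _ _ _ _ _ _ X]addn1.
apply: tsteps_trans _ IH.
by apply: (tstep1 (m := MLeft)) _ (tfupd_same _ _) _.
Qed.

Lemma tsteps_scan s q i : target (cact q) = i ->
  tsteps s (TScan q) 1 s (TScan q) (size (get s i)).+1 (size (get s i)).
Proof.
move=> qi; have : size (get s i) <= size (get s i) by [].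
elim: {1 3 4}(size (get s i)) => [_|n IH ni]; first exact: tsteps0.
rewrite -[X in tsteps _ _ _ _ _ _ X]add1n; apply: tsteps_trans (IH (ltnW ni)) _.
apply: (tstep1 (m := MRight)) _ (tfupd_same _ _) _ => //.
have [b] := store_tape_full ni; move: qi.
by rewrite /tdelta; case: (cact q) => [i' b' o|i' o k] /= -> ->.
Qed.

(** The round trip crosses the stack twice; the 4 covers leaving the origin, acting at the top and
    turning back. *)
Lemma tsteps_cstep s q : exists2 n, n <= 2 * size (get s (target (cact q))) + 4 &
  tsteps s (TRest (Some q)) 0 (cstep q s).2 (TRest (cstep q s).1) 0 n.
Proof.
set i := (X in get s X).
have H0 : tsteps s (TRest (Some q)) 0 s (TScan q) 1 1.
  exact: (tstep1 (m := MRight)) _ (tfupd_same _ _) _.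
have := tsteps_trans H0 (tsteps_scan (erefl i)).
rewrite /cstep; move: @i; case E: (cact q) => [i b o|i o k] /= H.
  exists (size (get s i) + (1 + (size (get s i) + 1))); first by lia.
  apply: (tsteps_trans _ (@tsteps_return _ _ (size (get s i)))).
  apply: tsteps_trans H _.
  apply: (tstep1 (m := MLeft)) _ (tfupd_push _ _ _) _ => //.
  by rewrite /tdelta E store_tape_top.
have H1 : tsteps s (TScan q) (size (get s i)).+1 s (TTop q) (size (get s i)) 1.
  apply: (tstep1 (m := MLeft)) _ (tfupd_same _ _) _ => //.
  by rewrite /tdelta E store_tape_top.
have {H1}H := tsteps_trans H H1.
case si: (get s i) => [|b r]; rewrite si /= in H *.
  exists (1 + (1 + (0 + 1))) => //; apply: tsteps_trans H _.
  by apply: (tstep1 (m := MStay)) _ (tfupd_same _ _) _; rewrite // /tdelta E.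
exists (size r + (1 + (1 + ((size r).+1 + 1)))); first by lia.
apply: (tsteps_trans _ (@tsteps_return _ _ (size r))).
apply: tsteps_trans H _.
apply: (tstep1 (m := MLeft)) _ (tfupd_pop si) _ => //.
by rewrite /tdelta E (store_tape_pop si).
Qed.

Lemma size_cstep s (q : cQ M) m : (forall i, size (get s i) <= m) ->
  forall i, size (get (cstep q s).2 i) <= m.+1.
Proof.
move=> sm i; rewrite /cstep; case: (cact q) => [j b o|j o k] /=.
  by rewrite get_set; case: ifP => _ /=; rewrite ?ltnS ?leqW.
case sj: (get s j) => [|b r] /=; rewrite ?leqW //.
rewrite get_set; case: ifP => _; rewrite ?leqW // (leq_trans _ (sm j)) // sj /=; lia.
Qed.

(** A stack grows by at most one cell per instruction, so heights stay below [m + n] throughout and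
    each of the [n] round trips has the same bound. *)
Lemma tsteps_reach (o o' : option (cQ M)) s s' n m : reach o s o' s' n ->
  (forall i, size (get s i) <= m) ->
  exists2 t, t <= n * (2 * (m + n) + 4) & tsteps s (TRest o) 0 s' (TRest o') 0 t.
Proof.
move=> H; elim: H m => {o s o' s' n} [o s|q s o s' n _ IH] m sm.
  by exists 0; first by [].
have [t1 t1le H1] := tsteps_cstep s q.
have [t2 t2le H2] := IH _ (size_cstep q sm).
exists (t2 + t1); last exact: tsteps_trans H1 H2.
set i := (X in get s X) in t1le; have := sm i; nia.
Qed.

Definition input_store (x : word) : store := St [::] (rev x) [::] [::] [::].

Lemma store_tape_init x : tape_at (store_tape (input_store x)) 1
  [:: (true, no_sym)] (map icell x).
Proof.
split=> [m|[|] //]; rewrite add1n /= -[nth _ _ _]/(nth bcell (map icell x) m).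
case: (ltnP m (size x)) => mx.
  rewrite (nth_map false) // /icell; congr pair; apply/ffunP=> i; rewrite !ffunE.
  case: eqVneq => [->|]; last by case: i => //=; rewrite ?onth0n ?eqxx.
  rewrite /= revK; have: (onth x m : bool) by rewrite onthTE.
  case E: (onth x m) => [b|] // _.
  by congr Some; apply: onth_nth.
rewrite nth_default ?size_map // /bcell; congr pair; apply/ffunP=> i; rewrite !ffunE.
by case: i => /=; rewrite ?onth0n ?revK ?onth_default.
Qed.

Lemma stackTM_run x s n : reach (centry M) (input_store x) None s n ->
  exists2 t, t <= n * (2 * (size x + n) + 4) + 4 &
    (tm_run stackTM t x).1.1 = TDone (sA s != [::]).
Proof.
move=> R.
have sx i : size (get (input_store x) i) <= size x by case: i; rewrite ?size_rev.
have [t tle T] := tsteps_reach R sx.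
(* Two steps mark the origin; two more at the end move to the first cell and read whether stack A is
   empty. *)
exists (1 + (1 + (t + 2))); first by lia.
have I2 : conf_at (input_store x) (TRest (centry M)) 0 (tm_run stackTM 2 x).
  split=> //.
  rewrite /tm_run /= /tm_init /=.
  have [H _] := store_tape_init x.
  split=> // -[|[|m]] //=.
    by have := H 0; case: x {R T sx tle H} => [|b x] /=.
  by have := H m.+1; case: x {R T sx tle H} => [|b x] //=; rewrite nth_nil.
have F1 : tsteps s (TRest None) 0 s TFin 1 1.
  exact: (tstep1 (m := MRight)) _ (tfupd_same _ _) _.
have F2 : tsteps s TFin 1 s (TDone (sA s != [::])) 1 1.
  apply: (tstep1 (m := MStay)) _ (tfupd_same _ _) _ => //.
  rewrite /tdelta store_tapeS onthTE size_rev -[get s iA]/(sA s).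
  by case: (sA s).
have := tsteps_trans T (tsteps_trans F1 F2) I2.
rewrite /tm_run -iterD => -[<- _]; congr (iter _ _ _).1.1; lia.
Qed.
End StackTM.

Lemma tm_run_halted (M : TM) x t t' : tm_halts_within M t x -> t <= t' ->
  tm_run M t' x = tm_run M t x.
Proof.
move=> H /subnK <-; rewrite /tm_run iterD; elim: (t' - t) => //= n ->.
by move: H; rewrite /tm_halts_within /tm_run /tm_step; case: (iter t _ _) => -[q l] r /= ->.
Qed.

Lemma in_P_prog (L : language) p h : polyb h ->
  (forall x, exists s n, [/\ n <= h (size x), exec p (input_store x) s n &
     sA s != [::] <-> L x]) -> in_P L.
Proof.
move=> hp H.
pose g n := h n * (2 * (n + h n) + 4) + 4.
have /poly_bound_polyb[c gc] : polyb g.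
  apply: polyb_add (polyb_const 4); apply: polyb_mul => //.
  apply: polyb_add (polyb_const 4); apply: polyb_mul (polyb_const 2) _.
  exact: polyb_add polyb_id hp.
exists (stackTM (compile p)), c => x.
have [s [n [nh /compileP R sL]]] := H x.
have [t tle E] := stackTM_run R.
have t_le : t <= poly_bound c (size x).
  apply: leq_trans (gc _); apply: leq_trans tle _; rewrite /g leq_add2r leq_mul // leq_add2r.
  by rewrite leq_mul2l leq_add2l nh.
have ht : tm_halts_within (stackTM (compile p)) t x by rewrite /tm_halts_within E.
by rewrite /tm_halts_within /tm_accepts_within (tm_run_halted ht t_le) E.
Qed.

Ltac polyb := repeat first
  [ exact: polyb_const | exact: polyb_id | assumption
  | apply: polyb_add | apply: polyb_mul | apply: polyb_exp ].

(** * Time bounds for stack programs and moves between stacks *)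

Lemma store_ext s s' : (forall i, get s i = get s' i) -> s = s'.
Proof.
case: s s' => a b c d e [a' b' c' d' e'] H.
by rewrite (H iA : a = a') (H iB : b = b') (H iC : c = c') (H iD : d = d') (H iE : e = e').
Qed.

Lemma size_exec p s s' n i : exec p s s' n -> size (get s' i) <= size (get s i) + n.
Proof.
elim=> {p s s' n} //=.
- by move=> s; rewrite addn0.
- by move=> j b s; rewrite get_set; case: eqP => [->|_] /=; lia.
- by move=> p q s1 s2 s3 m n _ IH1 _ IH2; lia.
- by move=> j pN pF pT s s' n _ _; lia.
- move=> j pN pF pT s s' b r n sj _; rewrite get_set.
  by case: eqP => [->|_]; rewrite ?sj /=; lia.
- by move=> *; lia.
- move=> j pF pT s s1 s2 b r m n sj _ + _; rewrite get_set.
  by case: eqP => [->|_]; rewrite ?sj /=; lia.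
Qed.

(** An upper bound instead of an exact time allows costs to be rounded to closed forms at each
    composition. *)
Definition runs p s s' n := exists2 m, m <= n & exec p s s' m.

Lemma runs_le p s s' m n : runs p s s' m -> m <= n -> runs p s s' n.
Proof. by move=> [k km H] mn; exists k => //; apply: leq_trans km mn. Qed.

Lemma runs_seq p q s1 s2 s3 m n :
  runs p s1 s2 m -> runs q s2 s3 n -> runs (Seq p q) s1 s3 (m + n).
Proof.
move=> [m' mm H1] [n' nn H2]; exists (m' + n'); first exact: leq_add.
exact: exec_seq H1 H2.
Qed.

Lemma runs_push i b s : runs (Push i b) s (set s i (b :: get s i)) 1.
Proof. by exists 1 => //; constructor. Qed.

Lemma runs_pop i pN pF pT s s' n :
  match get s i with
  | [::] => runs pN s s' n
  | b :: r => runs (if b then pT else pF) (set s i r) s' n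
  end -> runs (Pop i pN pF pT) s s' n.+1.
Proof.
case E: (get s i) => [|b r] [m mn H]; exists m.+1 => //; first exact: exec_popN.
exact: exec_popC E H.
Qed.

Lemma runs_while i pF pT s s1 s2 b r m n :
  get s i = b :: r -> runs (if b then pT else pF) (set s i r) s1 m ->
  runs (While i pF pT) s1 s2 n -> runs (While i pF pT) s s2 (m + n).+1.
Proof.
move=> E [m' mm H1] [n' nn H2]; exists (m' + n').+1; first by rewrite ltnS leq_add.
exact: exec_whileC E H1 H2.
Qed.

Lemma runs_while_end i pF pT s : get s i = [::] -> runs (While i pF pT) s s 1.
Proof. by exists 1 => //; constructor. Qed.

Definition pushs (js : seq idx) (v : seq bool) (s : store) : store :=
  foldr (fun j s => set s j (v ++ get s j)) s js.

Lemma get_pushs js v s i : uniq js ->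
  get (pushs js v s) i = if i \in js then v ++ get s i else get s i.
Proof.
elim: js => //= j js IH /andP[jjs ujs]; rewrite get_set inE.
case: eqVneq => [E|_] /=; last exact: IH.
by rewrite -E IH // E (negPf jjs).
Qed.

Definition emit (js : seq idx) (b : bool) : prog :=
  foldr (fun j p => Seq p (Push j b)) Skip js.

Lemma runs_emit js b s : runs (emit js b) s (pushs js [:: b] s) (size js).
Proof.
elim: js => [|j js IH] /=; first by exists 0 => //; constructor.
by rewrite -addn1; apply: runs_seq IH (runs_push _ _ _).
Qed.

Definition pour (i : idx) (js : seq idx) : prog := While i (emit js false) (emit js true).

Lemma runs_pour i js s : uniq js -> i \notin js ->
  runs (pour i js) s (pushs js (rev (get s i)) (set s i [::]))
    (size (get s i) * (size js).+1 + 1).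
Proof.
move=> ujs ijs.
suff H v : get s i = v -> runs (pour i js) s (pushs js (rev v) (set s i [::]))
  (size v * (size js).+1 + 1) by apply: H.
elim: v s => [|b r IH] s si.
  suff -> : pushs js (rev [::]) (set s i [::]) = s by rewrite mul0n; apply: runs_while_end.
  apply: store_ext => j; rewrite get_pushs // get_set.
  by case: eqP => [->|_]; rewrite ?si if_same.
pose s1 := pushs js [:: b] (set s i r).
have s1i : get s1 i = r by rewrite get_pushs // (negPf ijs) get_set eqxx.
have := IH s1; rewrite s1i => /(_ erefl) H.
have -> : pushs js (rev (b :: r)) (set s i [::]) = pushs js (rev r) (set s1 i [::]).
  apply: store_ext => j; rewrite !get_pushs // !get_set get_pushs // get_set.
  case: eqP => [->|_]; first by rewrite (negPf ijs).
  by case: ifP => // _; rewrite rev_cons cat_rcons.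
apply: runs_le (runs_while si _ H) _; last first.
  by rewrite /= mulSn -[(_ + _).+1]addSn addnA.
have <- : emit js b = if b then emit js true else emit js false by case: (b).
exact: runs_emit.
Qed.

(** * Serialised trees *)

Inductive tree := Leaf | Node of tree & tree.

Fixpoint ser (t : tree) : seq bool :=
  if t is Node t1 t2 then true :: ser t1 ++ ser t2 else [:: false].

Lemma size_ser_gt0 t : 0 < size (ser t). Proof. by case: t. Qed.

(** Stack C holds in unary the number of subtrees still to be read: every pass uses up one, and a
    node bit adds two. *)
Definition take_loop (js : seq idx) : prog :=
  While iC Skip (Pop iA Skip (emit js false)
    (Seq (emit js true) (Seq (Push iC true) (Push iC true)))).
Definition take_tree (js : seq idx) : prog := Seq (Push iC true) (take_loop js).

(** The loop does not stop after one tree when others are pending. The statement is therefore in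
    continuation form: any run from the state after [t] is prolonged backwards over the reading of
    [t], and a node chains its two subtrees. *)
Lemma runs_take_loop js t s a c s' n : uniq js -> iA \notin js -> iC \notin js ->
  get s iA = ser t ++ a -> get s iC = true :: c ->
  runs (take_loop js) (pushs js (rev (ser t)) (set (set s iA a) iC c)) s' n ->
  runs (take_loop js) s s' (n + (size js + 4) * size (ser t)).
Proof.
move=> ujs jA jC.
elim: t s a c n => [|t1 IH1 t2 IH2] s a c n hA hC H.
  have E : set (set s iA a) iC c = set (set s iC c) iA a by case: (s).
  rewrite E in H; apply: runs_le; first apply: (runs_while hC _ H).
    by apply: runs_pop; rewrite get_set [iA == iC]/= hA [ser _ ++ _]/=; apply: runs_emit.
  by rewrite [size (ser _)]/=; move: (size js) => k; lia.
pose s1 := set (pushs js [:: true] (set (set s iC c) iA (ser t1 ++ ser t2 ++ a)))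
  iC (true :: true :: c).
pose s2 := pushs js (rev (ser t1)) (set (set s1 iA (ser t2 ++ a)) iC (true :: c)).
have H2 : runs (take_loop js) s2 s' (n + (size js + 4) * size (ser t2)).
  apply: (IH2 _ a c).
  - by rewrite get_pushs // (negPf jA) !get_set.
  - by rewrite get_pushs // (negPf jC) !get_set.
  congr (runs _ _ _ _): H; apply: store_ext => j.
  rewrite !(get_set, get_pushs) //.
  case: (eqVneq j iC) => [->|_]; first by rewrite (negPf jC).
  case: (eqVneq j iA) => [->|_]; first by rewrite (negPf jA).
  case: ifP => // _.
  by rewrite /= rev_cons rev_cat cat_rcons -!catA.
have H1 : runs (take_loop js) s1 s' (n + (size js + 4) * size (ser t2) + (size js + 4) * size (ser t1)).
  apply: (IH1 _ (ser t2 ++ a) (true :: c)) => //.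
    by rewrite !get_set get_pushs // (negPf jA) !get_set.
  by rewrite get_set.
apply: runs_le; first apply: (runs_while (s1 := s1) (m := (size js + (1 + 1)).+1) hC _ H1).
  apply: runs_pop; rewrite get_set [iA == iC]/= hA [ser _ ++ _]/= -catA.
  apply: runs_seq; first exact: runs_emit.
  have -> : s1 = set (set (pushs js [:: true] (set (set s iC c) iA (ser t1 ++ ser t2 ++ a)))
     iC (true :: c)) iC (true :: true :: c).
    by apply: store_ext => j; rewrite !get_set; case: eqP.
  set s3 := set _ iC (true :: c).
  have s3C : get s3 iC = true :: c by rewrite get_set.
  apply: (runs_seq (s2 := s3)); last by rewrite -s3C; apply: runs_push.
  have -> : s3 = set (pushs js [:: true] (set (set s iC c) iA (ser t1 ++ ser t2 ++ a)))
     iC (true :: get (pushs js [:: true] (set (set s iC c) iA (ser t1 ++ ser t2 ++ a))) iC).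
    by rewrite get_pushs // (negPf jC) !get_set.
  exact: runs_push.
rewrite [size (ser (Node _ _))]/= size_cat; move: (size js) => k; nia.
Qed.

Lemma runs_take js t s a : uniq js -> iA \notin js -> iC \notin js ->
  get s iA = ser t ++ a -> get s iC = [::] ->
  runs (take_tree js) s (pushs js (rev (ser t)) (set s iA a))
    ((size js + 4) * size (ser t) + 2).
Proof.
move=> ujs jA jC hA hC.
apply: runs_le; first apply: runs_seq; first exact: runs_push.
  apply: (@runs_take_loop js t _ a [::] _ 1) => //.
  - by rewrite get_set.
  - by rewrite get_set hC.
  set s1 := (X in runs _ X).
  have -> : s1 = pushs js (rev (ser t)) (set s iA a).
    apply: store_ext => j; rewrite !get_pushs // !get_set.
    case: (eqVneq j iC) => [->|_] //.
    by rewrite (negPf jC) hC.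
  by apply: runs_while_end; rewrite get_pushs // (negPf jC) get_set hC.
by rewrite addnA addnC.
Qed.

Definition rest (a : seq bool) : store := St a [::] [::] [::] [::].

Lemma runs_pourA i s v : i != iA -> get s i = rev v ->
  runs (pour i [:: iA]) s (set (set s i [::]) iA (v ++ get s iA)) (2 * size v + 1).
Proof.
move=> iNA si; have := @runs_pour i [:: iA] s isT; rewrite inE iNA => /(_ isT).
by rewrite /pushs /foldr si revK size_rev get_set eq_sym (negPf iNA) mulnC.
Qed.

Definition dup_prog : prog :=
  Seq (take_tree [:: iB; iD]) (Seq (pour iB [:: iA]) (pour iD [:: iA])).

Lemma runs_dup t a : runs dup_prog (rest (ser t ++ a)) (rest (ser t ++ ser t ++ a))
  (20 * size (ser t)).
Proof.
have := size_ser_gt0 t => t0.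
apply: runs_le.
  apply: runs_seq; first exact: (@runs_take _ t _ a).
  rewrite /= !cats0.
  apply: runs_seq; first exact: (@runs_pourA iB _ (ser t)).
  exact: (@runs_pourA iD _ (ser t)).
rewrite [size [:: _; _]]/=; lia.
Qed.

Definition swap_prog : prog :=
  Seq (take_tree [:: iB]) (Seq (take_tree [:: iD]) (Seq (pour iB [:: iA]) (pour iD [:: iA]))).

(** Stack E is arbitrary because the fold loop swaps while it keeps the current list element
    there. *)
Lemma runs_swap t u a e : runs swap_prog (St (ser t ++ ser u ++ a) [::] [::] [::] e)
  (St (ser u ++ ser t ++ a) [::] [::] [::] e) (20 * (size (ser t) + size (ser u))).
Proof.
have := (size_ser_gt0 t, size_ser_gt0 u) => -[t0 u0].
apply: runs_le.
  apply: runs_seq; first exact: (@runs_take _ t _ (ser u ++ a)).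
  apply: runs_seq; first exact: (@runs_take _ u _ a).
  rewrite /= !cats0.
  apply: runs_seq; first exact: (@runs_pourA iB _ (ser t)).
  exact: (@runs_pourA iD _ (ser u)).
rewrite [size [:: iB]]/= [size [:: iD]]/=; lia.
Qed.

Definition drop_prog : prog := take_tree [::].

Lemma runs_drop t a : runs drop_prog (rest (ser t ++ a)) (rest a) (6 * size (ser t)).
Proof.
have t0 := size_ser_gt0 t.
apply: runs_le; first exact: (@runs_take _ t _ a).
rewrite /=; lia.
Qed.

Definition push_all (v : seq bool) : prog :=
  foldr (fun b p => Seq p (Push iA b)) Skip v.

Lemma runs_push_all v a b c d e :
  runs (push_all v) (St a b c d e) (St (v ++ a) b c d e) (size v).
Proof.
elim: v => [|x v IH] /=; first by exists 0 => //; constructor.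
by rewrite -addn1; apply: runs_seq IH (runs_push _ _ _).
Qed.

(** * Polynomial-time functions *)

Class Enc (T : Type) := enc : T -> tree.
Definition sz T {eT : Enc T} (x : T) : nat := size (ser (enc x)).

Lemma sz_gt0 T {eT : Enc T} (x : T) : 0 < sz x. Proof. exact: size_ser_gt0. Qed.

#[global] Instance enc_tree : Enc tree := id.
#[global] Instance enc_unit : Enc unit := fun=> Leaf.
(** [true] has the shape of a pair of units, and below a nonempty list has the shape of the pair of
    its head and tail. Hence a single case distinction on leaf or node yields both the conditional
    and list matching, and consing is a mere change of type. *)
#[global] Instance enc_bool : Enc bool := fun b => if b then Node Leaf Leaf else Leaf.
#[global] Instance enc_prod T U (eT : Enc T) (eU : Enc U) : Enc (T * U) :=
  fun x => Node (enc x.1) (enc x.2).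
#[global] Instance enc_seq T (eT : Enc T) : Enc (seq T) :=
  foldr (fun x t => Node (enc x) t) Leaf.

Lemma sz_pair T U {eT : Enc T} {eU : Enc U} (x : T) (y : U) : sz (x, y) = (sz x + sz y).+1.
Proof. by rewrite /sz /= size_cat. Qed.
Lemma sz_cons T {eT : Enc T} (x : T) l : sz (x :: l) = (sz x + sz l).+1.
Proof. by rewrite /sz /= size_cat. Qed.
Lemma sz_nil T {eT : Enc T} : sz ([::] : seq T) = 1. Proof. by []. Qed.

Definition computes T U {eT : Enc T} {eU : Enc U} (p : prog) (f : T -> U) (h : nat -> nat) :=
  forall x a, runs p (rest (ser (enc x) ++ a)) (rest (ser (enc (f x)) ++ a)) (h (sz x)).

(* Polynomial-time computable functions between types with a tree encoding:
   a program replaces the serialised argument on top of stack A, whatever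
   lies below it, by the serialised value. *)
Definition fp T U {eT : Enc T} {eU : Enc U} (f : T -> U) : Prop :=
  exists p c, computes p f (fun n => (n + 2) ^ c).

Section Basics.
Context {T U : Type} {eT : Enc T} {eU : Enc U}.

Lemma fpI p (f : T -> U) h : polyb h -> computes p f h -> fp f.
Proof. by move=> [c hc] H; exists p, c => x a; apply: runs_le (H x a) (hc _). Qed.

Lemma fp_size (f : T -> U) : fp f -> exists2 h, polyb h & forall x, sz (f x) <= h (sz x).
Proof.
move=> [p [c H]]; exists (fun n => n + (n + 2) ^ c); first by polyb.
move=> x; have [m mh /(size_exec iA)] := H x [::].
by rewrite /= !cats0 => /leq_trans; apply; rewrite leq_add2l.
Qed.

Lemma eq_fp (f g : T -> U) : f =1 g -> fp f -> fp g.
Proof. by move=> fg [p [c H]]; exists p, c => x a; rewrite -fg; apply: H. Qed.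
End Basics.

Lemma leq_exp_base m n c : m <= n -> m ^ c <= n ^ c.
Proof. by move=> mn; case: c => // c; rewrite leq_exp2r. Qed.

Section Closure.
Context {T U V Y : Type} {eT : Enc T} {eU : Enc U} {eV : Enc V} {eY : Enc Y}.

Lemma fp_comp (f : T -> U) (g : U -> V) : fp f -> fp g -> fp (fun x => g (f x)).
Proof.
move=> ff [q [d Hq]]; have [h hp hf] := fp_size ff; have [p [c Hp]] := ff.
apply: (@fpI _ _ _ _ (Seq p q) _ (fun n => (n + 2) ^ c + (h n + 2) ^ d)) => [|x a].
  by polyb.
apply: runs_le; first exact: runs_seq (Hp x a) (Hq (f x) a).
by rewrite leq_add2l leq_exp_base // leq_add2r.
Qed.

Lemma fp_cast (f : T -> U) : (forall x, enc (f x) = enc x) -> fp f.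
Proof.
move=> fE; apply: (@fpI _ _ _ _ Skip _ (fun=> 0)) => [|x a]; first by polyb.
by rewrite fE; exists 0 => //; constructor.
Qed.

Lemma fp_const (u : U) : fp (fun _ : T => u).
Proof.
pose k := size (ser (@enc _ eU u)).
apply: (@fpI _ _ _ _ (Seq drop_prog (push_all (ser (enc u)))) (fun _ : T => u) (fun n => 6 * n + k)) => [|x a].
  by polyb.
exact: runs_seq (runs_drop _ _) (runs_push_all _ _ _ _ _ _).
Qed.

Lemma fp_fst : fp (@fst T U).
Proof.
apply: (@fpI _ _ _ _ (Pop iA Skip Skip (Seq swap_prog drop_prog)) _ (fun n => 50 * n)) => [|[x y] a].
  by polyb.
apply: runs_le; first apply: runs_pop => /=.
  rewrite -catA; apply: runs_seq; first exact: runs_swap.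
  exact: runs_drop.
rewrite sz_pair /= -/(sz x) -/(sz y); lia.
Qed.

Lemma fp_snd : fp (@snd T U).
Proof.
apply: (@fpI _ _ _ _ (Pop iA Skip Skip drop_prog) _ (fun n => 50 * n)) => [|[x y] a].
  by polyb.
apply: runs_le; first apply: runs_pop => /=.
  by rewrite -catA; apply: runs_drop.
rewrite sz_pair /= -/(sz x) -/(sz y); lia.
Qed.

Lemma fp_pair (f : T -> U) (g : T -> V) : fp f -> fp g -> fp (fun x => (f x, g x)).
Proof.
move=> ff fg; have [hf phf Hf] := fp_size ff; have [hg phg Hg] := fp_size fg.
have [p [c Hp]] := ff; have [q [d Hq]] := fg.
apply: (@fpI _ _ _ _
  (Seq dup_prog (Seq p (Seq swap_prog (Seq q (Seq swap_prog (Push iA true)))))) _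
  (fun n => 20 * n + ((n + 2) ^ c + (20 * (hf n + n) + ((n + 2) ^ d + (20 * (hg n + hf n) + 1))))))
  => [|x a]; first by polyb.
apply: runs_le.
  apply: runs_seq; first exact: runs_dup.
  apply: runs_seq; first exact: Hp.
  apply: runs_seq; first exact: runs_swap.
  apply: runs_seq; first exact: Hq.
  apply: runs_seq; first exact: runs_swap.
  have := runs_push iA true (rest (ser (enc (f x)) ++ ser (enc (g x)) ++ a)).
  by rewrite /rest /= -catA; apply.
rewrite -/(sz x) -/(sz (f x)) -/(sz (g x)); have := Hf x; have := Hg x; lia.
Qed.

(* Branching on whether the encoding of [w x] is a leaf; [dest] is the
   corresponding destructor. *)
Lemma fp_case W {eW : Enc W} (dest : W -> option (Y * V)) (w : T -> W)
    (f : T -> U) (g : T * (Y * V) -> U) :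
  (forall z, enc z = if dest z is Some yv then enc yv else Leaf) ->
  fp w -> fp f -> fp g ->
  fp (fun x => if dest (w x) is Some yv then g (x, yv) else f x).
Proof.
move=> Hd fw [q [d Hq]] [r [e Hr]]; have [h ph Hw] := fp_size fw.
have [p [c Hp]] := fw.
pose k n := (n + 2) ^ d + (1 + (20 * (h n + n) + (1 + (n + h n + 1 + 2) ^ e))).
(* The test pops the root bit of [w x]. If it was a leaf, only [x] remains on top; if it was a node,
   the bit is put back, and a swap and one more node bit form the pair of [x] with the two
   subtrees. *)
apply: (@fpI _ _ _ _
  (Seq dup_prog (Seq p (Pop iA Skip q
    (Seq (Push iA true) (Seq swap_prog (Seq (Push iA true) r)))))) _
  (fun n => 20 * n + ((n + 2) ^ c + (k n + 1))))
  => [|x a]; first by rewrite /k; polyb.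
apply: runs_seq; first exact: runs_dup.
apply: runs_seq; first exact: Hp.
rewrite addn1; apply: runs_pop; have := Hw x; rewrite {1}/sz Hd.
case: (dest (w x)) => [[y v]|] /=.
  rewrite size_cat => hx; have {}hx : (sz y + sz v).+1 <= h (sz x) := hx.
  apply: runs_le.
    apply: runs_seq; first exact: runs_push.
    apply: runs_seq; first exact: (@runs_swap (enc (y, v)) (enc x)).
    apply: runs_seq; first exact: runs_push.
    have := Hr (x, (y, v)) a; rewrite /= -catA; apply.
  rewrite /= -/(sz x) !sz_pair size_cat /k.
  have -> : (sz x + (sz y + sz v).+1).+1 + 2 = sz x + (sz y + sz v).+1 + 1 + 2 by lia.
  have : (sz x + (sz y + sz v).+1 + 1 + 2) ^ e <= (sz x + h (sz x) + 1 + 2) ^ e.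
    by apply: leq_exp_base; lia.
  rewrite -/(sz y) -/(sz v); lia.
by move=> _; apply: runs_le (Hq x a) _; rewrite /k leq_addr.
Qed.

(** The flag on C is popped before each pass, so [p] starts with only stack A in use; it is pushed
    again only if the list had an element. On the empty list the popped bit is its whole encoding,
    and the accumulator is left on top. *)
Definition fold_step (p : prog) : prog :=
  Pop iA Skip Skip (Seq (take_tree [:: iE]) (Seq swap_prog (Seq (pour iE [:: iA])
    (Seq (Push iA true) (Seq p (Seq swap_prog (Push iC true))))))).
Definition fold_prog (p : prog) : prog :=
  Pop iA Skip Skip (Seq (Push iC true) (While iC Skip (fold_step p))).

Lemma runs_fold_loop p c (f : Y * U -> U) m l u a : computes p f (fun n => (n + 2) ^ c) ->
  (forall n, sz (foldl (fun v y => f (y, v)) u (take n l)) <= m) -> sz l <= m ->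
  runs (While iC Skip (fold_step p)) (St (ser (enc l) ++ ser (enc u) ++ a) [::] [:: true] [::] [::])
    (rest (ser (enc (foldl (fun v y => f (y, v)) u l)) ++ a))
    (size l * (100 * m + (2 * m + 3) ^ c) + 5).
Proof.
move=> Hp; elim: l u => [|y l IH] u Hm Hl.
  apply: runs_le; first apply: (@runs_while _ _ _ _ _ _ true [::]) => //=.
    by apply: runs_pop => /=; exists 0 => //; constructor.
    exact: runs_while_end.
  by rewrite mul0n.
have {}IH : runs (While iC Skip (fold_step p))
   (St (ser (enc l) ++ ser (enc (f (y, u))) ++ a) [::] [:: true] [::] [::])
    (rest (ser (enc (foldl (fun v y => f (y, v)) u (y :: l))) ++ a))
    (size l * (100 * m + (2 * m + 3) ^ c) + 5).
  apply: IH => [n|]; first exact: (Hm n.+1).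
  by move: Hl; rewrite sz_cons; lia.
have Hu := Hm 0; have Hu' := Hm 1; rewrite /= take0 /= in Hu Hu'.
rewrite sz_cons in Hl.
apply: runs_le; first apply: (@runs_while _ _ _ _ _ _ true [::] _ _ _ _ IH) => //=.
  apply: runs_pop => /=.
  rewrite -catA; apply: runs_seq; first exact: (@runs_take _ (enc y) _).
  rewrite /= cats0; apply: runs_seq; first exact: (@runs_swap (enc l) (enc u)).
  apply: runs_seq; first exact: (@runs_pourA iE _ (ser (enc y))).
  apply: runs_seq; first exact: runs_push.
  apply: runs_seq.
    by have := Hp (y, u) (ser (enc_seq eY l) ++ a); rewrite /= -catA; apply.
  apply: runs_seq; first exact: runs_swap.
  exact: runs_push.
rewrite -/(sz l) -/(sz y) -/(sz u) -/(sz (f (y, u))) sz_pair.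
rewrite [size [:: iE]]/= [size (y :: l)]/=.
have : ((sz y + sz u).+1 + 2) ^ c <= (2 * m + 3) ^ c by apply: leq_exp_base; lia.
have := (sz_gt0 y, sz_gt0 l) => -[y0 l0].
rewrite [(size l).+1 * _]mulSn; move: (size l * _) => K.
move: (((sz y + sz u).+1 + 2) ^ c) ((2 * m + 3) ^ c) => X Z.
move: (sz l) (sz y) (sz u) (sz (f (y, u))) Hl Hu Hu' y0 l0; lia.
Qed.
End Closure.

Lemma size_sz T {eT : Enc T} (l : seq T) : size l < sz l.
Proof. by elim: l => //= x l IH; rewrite sz_cons; lia. Qed.

(** Iterating a polynomial-time step may double the accumulator in each round, hence the bound on
    every partial fold, expressed with [take n]. The loop body sees only an element and an
    accumulator, so the parameter [x] travels inside the accumulator. *)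
Lemma fp_foldl T U Y {eT : Enc T} {eU : Enc U} {eY : Enc Y}
    (l : T -> seq Y) (u0 : T -> U) (f : T * U * Y -> U) h :
  fp l -> fp u0 -> fp f -> polyb h ->
  (forall x n, sz (foldl (fun u y => f (x, u, y)) (u0 x) (take n (l x))) <= h (sz x)) ->
  fp (fun x => foldl (fun u y => f (x, u, y)) (u0 x) (l x)).
Proof.
move=> fl fu ff ph Hh.
pose body (z : Y * (T * U)) : T * U := (z.2.1, f (z.2.1, z.2.2, z.1)).
have fbody : fp body.
  apply: fp_pair; first exact: fp_comp fp_snd fp_fst.
  apply: fp_comp ff; apply: fp_pair fp_fst.
  apply: fp_pair; first exact: fp_comp fp_snd fp_fst.
  exact: fp_comp fp_snd fp_snd.
have [p [c Hp]] := fbody.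
pose init x : seq Y * (T * U) := (l x, (x, u0 x)).
have finit : fp init.
  by apply: fp_pair fl _; apply: fp_pair fu; apply: fp_cast.
have [hl phl Hl] := fp_size fl.
have foldE x s : foldl (fun v y => body (y, v)) (x, u0 x) s =
                 (x, foldl (fun u y => f (x, u, y)) (u0 x) s).
  by elim: s (u0 x) => //= y s IH u; rewrite /body /= IH.
have H : fp (fun x => foldl (fun v y => body (y, v)) (x, u0 x) (l x)); last first.
  by apply: (eq_fp _ (fp_comp H fp_snd)) => x; rewrite foldE.
have [q [d Hq]] := finit.
pose m n := n + h n + 1 + hl n.
apply: (@fpI _ _ _ _ (Seq q (fold_prog p)) _
  (fun n => (n + 2) ^ d + (1 + (1 + (hl n * (100 * m n + (2 * m n + 3) ^ c) + 5))))) => [|x a].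
  by rewrite /m; polyb.
apply: runs_seq; first exact: Hq.
apply: runs_pop => /=; apply: runs_seq; first exact: runs_push.
rewrite /= -catA.
apply: runs_le; first apply: (@runs_fold_loop _ _ _ _ p c body (m (sz x)) (l x) (x, u0 x) a Hp).
- by move=> n; rewrite foldE sz_pair; have := Hh x n; rewrite /m; lia.
- by have := Hl x; rewrite /m; lia.
rewrite leq_add2r leq_mul2r; apply/orP; right.
by apply: leq_trans (Hl x); apply/ltnW/size_sz.
Qed.

Lemma fp_size_exp T U {eT : Enc T} {eU : Enc U} (f : T -> U) :
  fp f -> exists c, forall x, sz (f x) <= (sz x + 2) ^ c.
Proof.
move=> /fp_size[h [c hc] H]; exists c => x; exact: leq_trans (H x) (hc _).
Qed.

Section Derived.
Context {T U V Y : Type} {eT : Enc T} {eU : Enc U} {eV : Enc V} {eY : Enc Y}.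

Lemma fp_id : fp (fun x : T => x).
Proof. exact: fp_cast. Qed.

Lemma fp_pfst (f : T -> U * V) : fp f -> fp (fun x => (f x).1).
Proof. by move=> ff; apply: fp_comp ff fp_fst. Qed.

Lemma fp_psnd (f : T -> U * V) : fp f -> fp (fun x => (f x).2).
Proof. by move=> ff; apply: fp_comp ff fp_snd. Qed.

Lemma fp_cons (f : T -> U) (l : T -> seq U) : fp f -> fp l -> fp (fun x => f x :: l x).
Proof.
move=> ff fl; have F := fp_pair ff fl.
by apply: (fp_comp (g := fun p => p.1 :: p.2) F); apply: fp_cast => -[].
Qed.

Lemma fp_if (b : T -> bool) (f g : T -> U) :
  fp b -> fp f -> fp g -> fp (fun x => if b x then f x else g x).
Proof.
move=> fb ff fg; pose dest (b : bool) := if b then Some (tt, tt) else None.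
have F : fp (fun x => if dest (b x) is Some yv then f (x, yv).1 else g x).
  by apply: (fp_case (g := fun z => f z.1)) => //; [case | apply: fp_comp fp_fst ff].
by apply: (eq_fp _ F) => x; rewrite /dest; case: (b x).
Qed.

Lemma fp_seq_case (l : T -> seq Y) (f : T -> U) (g : T * (Y * seq Y) -> U) :
  fp l -> fp f -> fp g ->
  fp (fun x => if l x is y :: r then g (x, (y, r)) else f x).
Proof.
move=> fl ff fg; pose dest (s : seq Y) := if s is y :: r then Some (y, r) else None.
have F : fp (fun x => if dest (l x) is Some yv then g (x, yv) else f x).
  by apply: fp_case => // -[].
by apply: (eq_fp _ F) => x; rewrite /dest; case: (l x).
Qed.
End Derived.

Ltac fp := try assumption;
  lazymatch goal with
  | |- fp (fun x => x) => exact: fp_id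
  | |- fp fst => exact: fp_fst
  | |- fp snd => exact: fp_snd
  | |- fp (fun x => (@?f x, @?g x)) => apply: (fp_pair (f := f) (g := g)); fp
  | |- fp (fun x => (@?f x).1) => apply: (fp_pfst (f := f)); fp
  | |- fp (fun x => (@?f x).2) => apply: (fp_psnd (f := f)); fp
  | |- fp (fun x => @?f x :: @?g x) => apply: (fp_cons (f := f) (l := g)); fp
  | |- fp (fun _ => ?u) => exact: fp_const
  | _ => idtac
  end.

(** * List operations in polynomial time *)

Section Lists.
Context {T Y : Type} {eT : Enc T} {eY : Enc Y}.

Lemma fp_andb (b c : T -> bool) : fp b -> fp c -> fp (fun x => b x && c x).
Proof. by move=> fb fc; apply: (fp_if fb fc); apply: fp_const. Qed.

Lemma fp_orb (b c : T -> bool) : fp b -> fp c -> fp (fun x => b x || c x).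
Proof. by move=> fb fc; apply: (fp_if fb _ fc); apply: fp_const. Qed.

Lemma fp_negb (b : T -> bool) : fp b -> fp (fun x => ~~ b x).
Proof. by move=> fb; apply: (fp_if fb); apply: fp_const. Qed.

Lemma fp_nilp (l : T -> seq Y) : fp l -> fp (fun x => nilp (l x)).
Proof.
move=> fl; apply: (eq_fp _ (fp_seq_case fl (fp_const true) (fp_const false))) => x.
by case: (l x).
Qed.

Lemma fp_behead (l : T -> seq Y) : fp l -> fp (fun x => behead (l x)).
Proof.
move=> fl.
have F : fp (fun z : T * (Y * seq Y) => z.2.2) by fp.
by apply: (eq_fp _ (fp_seq_case fl (fp_const [::]) F)) => x; case: (l x).
Qed.

Lemma fp_head (d : Y) (l : T -> seq Y) : fp l -> fp (fun x => head d (l x)).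
Proof.
move=> fl.
have F : fp (fun z : T * (Y * seq Y) => z.2.1) by fp.
by apply: (eq_fp _ (fp_seq_case fl (fp_const d) F)) => x; case: (l x).
Qed.

Lemma sz_catrev (s t : seq Y) : (sz (catrev s t)).+1 = sz s + sz t.
Proof. by elim: s t => //= y s IH t; rewrite IH !sz_cons; lia. Qed.

Lemma sz_take n (s : seq Y) : sz (take n s) <= sz s.
Proof. by elim: s n => [|y s IH] [|n] //=; rewrite !sz_cons; have := IH n; lia. Qed.

Lemma fp_catrev (l m : T -> seq Y) : fp l -> fp m -> fp (fun x => catrev (l x) (m x)).
Proof.
move=> fl fm; have [hl pl Hl] := fp_size fl; have [hm pm Hm] := fp_size fm.
have F : fp (fun z : T * seq Y * Y => z.2 :: z.1.2) by fp.
have E s t : foldl (fun u (y : Y) => y :: u) t s = catrev s t by elim: s t => //=.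
apply: (eq_fp _ (@fp_foldl _ _ _ _ _ _ l m _ (fun n => hl n + hm n) fl fm F _ _)).
- by move=> x; rewrite E.
- by polyb.
move=> x n; rewrite E; have := sz_catrev (take n (l x)) (m x).
by have := sz_take n (l x); have := Hl x; have := Hm x; lia.
Qed.

Lemma fp_rev (l : T -> seq Y) : fp l -> fp (fun x => rev (l x)).
Proof. by move=> fl; apply: fp_catrev fl (fp_const _). Qed.

Lemma fp_cat (l m : T -> seq Y) : fp l -> fp m -> fp (fun x => l x ++ m x).
Proof.
move=> fl fm; apply: (eq_fp _ (fp_catrev (fp_rev fl) fm)) => x.
by rewrite catrevE revK.
Qed.

End Lists.

Section FlattenMap.
Context {T Y Z : Type} {eT : Enc T} {eY : Enc Y} {eZ : Enc Z}.

Lemma fp_flatten_map (l : T -> seq Y) (g : T * Y -> seq Z) : fp l -> fp g ->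
  fp (fun x => flatten [seq g (x, y) | y <- l x]).
Proof.
move=> fl fg; have [hl pl Hl] := fp_size fl; have [c Hc] := fp_size_exp fg.
(* The accumulator holds the result reversed, as a fold adds at the front; one final [rev] restores
   the order. *)
have F : fp (fun z : T * seq Z * Y => catrev (g (z.1.1, z.2)) z.1.2).
  by apply: fp_catrev; fp; apply: fp_comp fg; fp.
have E x s t : foldl (fun u (y : Y) => catrev (g (x, y)) u) t s =
    catrev (flatten [seq g (x, y) | y <- s]) t.
  by elim: s t => //= y s IH t; rewrite IH !catrevE rev_cat catA.
have H : fp (fun x => foldl (fun u (y : Y) => catrev (g (x, y)) u) [::] (l x)); last first.
  by apply: (eq_fp _ (fp_rev H)) => x; rewrite E -/(rev _) revK.
apply: (fp_foldl (h := fun n => 1 + hl n * (n + hl n + 1 + 2) ^ c) fl (fp_const _) F).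
  by polyb.
move=> x n; rewrite /=; set K := (_ + _) ^ c.
(* An element is no larger than its list, so one constant [K] bounds all the images and the
   accumulator grows only linearly in the length. *)
have KP y : sz y <= sz (l x) -> sz (g (x, y)) <= K.
  move=> yl; apply: leq_trans (Hc _) _; apply: leq_exp_base.
  by rewrite sz_pair; have := Hl x; lia.
clearbody K; have S (s : seq Y) (t : seq Z) : sz s <= sz (l x) ->
    sz (foldl (fun u y => catrev (g (x, y)) u) t s) <= sz t + size s * K.
  elim: s t => [|y s IH] t; first by rewrite addn0.
  rewrite sz_cons [foldl _ _ _]/= => ys; apply: leq_trans (IH _ _) _; first by lia.
  have Ky : sz (g (x, y)) <= K by apply: KP; lia.
  have := @sz_catrev _ eZ (g (x, y)) t; rewrite [size (y :: s)]/= [(size s).+1 * K]mulSn.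
  by move: (size s * K) => N; lia.
apply: leq_trans (S _ _ (sz_take _ _)) _; rewrite leq_add2l leq_mul2r.
apply/orP; right; apply: leq_trans (Hl x); apply: leq_trans (ltnW (size_sz _)).
by rewrite size_take_min geq_minr.
Qed.
End FlattenMap.

Section MapFilter.
Context {T Y Z : Type} {eT : Enc T} {eY : Enc Y} {eZ : Enc Z}.

Lemma fp_map (l : T -> seq Y) (g : T * Y -> Z) : fp l -> fp g ->
  fp (fun x => [seq g (x, y) | y <- l x]).
Proof.
move=> fl fg; have F : fp (fun z => [:: g z]) by fp.
by apply: (eq_fp _ (fp_flatten_map fl F)) => x; elim: (l x) => //= y s ->.
Qed.

Lemma fp_filter (l : T -> seq Y) (b : T * Y -> bool) : fp l -> fp b ->
  fp (fun x => [seq y <- l x | b (x, y)]).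
Proof.
move=> fl fb; have F : fp (fun z => if b z then [:: z.2] else [::]).
  by apply: fp_if => //; fp.
by apply: (eq_fp _ (fp_flatten_map fl F)) => x; elim: (l x) => //= y s ->; case: (b _).
Qed.

Lemma fp_has (l : T -> seq Y) (b : T * Y -> bool) : fp l -> fp b ->
  fp (fun x => has (fun y => b (x, y)) (l x)).
Proof.
move=> fl fb; apply: (eq_fp _ (fp_negb (fp_nilp (fp_filter fl fb)))) => x.
by rewrite /nilp size_filter has_count lt0n.
Qed.

Lemma fp_all (l : T -> seq Y) (b : T * Y -> bool) : fp l -> fp b ->
  fp (fun x => all (fun y => b (x, y)) (l x)).
Proof.
move=> fl fb; apply: (eq_fp _ (fp_negb (fp_has fl (fp_negb fb)))) => x.
by rewrite /= -all_predC; apply: eq_all => y /=; rewrite negbK.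
Qed.
End MapFilter.

Lemma sz_bool (b : bool) : sz b <= 3. Proof. by case: b. Qed.

Lemma sz_behead Y {eY : Enc Y} (s : seq Y) : sz (behead s) <= sz s.
Proof. by case: s => //= y s; rewrite sz_cons; lia. Qed.

(** The test [~~ nilp u.1] prevents the default value of [head] from matching a bit once the word is
    exhausted. *)
Definition eq_step (u : seq bool * bool) (c : bool) : seq bool * bool :=
  (behead u.1, u.2 && (~~ nilp u.1 && (head false u.1 == c))).

Lemma fold_eq_step (v w : seq bool) b :
  let u := foldl eq_step (w, b) v in nilp u.1 && u.2 = b && (v == w).
Proof.
rewrite /=; elim: v w b => [|c v IH] w b /=; first by case: w => [|d w] /=; case: b.
rewrite IH; case: w => [|d w] /=; first by rewrite !andbF.
by rewrite eqseq_cons -andbA (eq_sym d).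
Qed.

Lemma fp_eqb T {eT : Enc T} (b c : T -> bool) : fp b -> fp c -> fp (fun x => b x == c x).
Proof.
move=> fb fc; apply: (eq_fp _ (fp_if fb fc (fp_negb fc))) => x.
by case: (b x); case: (c x).
Qed.

Lemma fp_eq_word T {eT : Enc T} (v w : T -> seq bool) : fp v -> fp w -> fp (fun x => v x == w x).
Proof.
move=> fv fw; have [hw pw Hw] := fp_size fw.
have F : fp (fun z : T * (seq bool * bool) * bool => eq_step z.1.2 z.2).
  apply: fp_pair; first by apply: fp_behead; fp.
  apply: fp_andb; first by fp.
  apply: fp_andb; first by apply/fp_negb/fp_nilp; fp.
  by apply: fp_eqb; [apply: fp_head|]; fp.
have H : fp (fun x => foldl eq_step (w x, true) (v x)).
  have F0 : fp (fun x => (w x, true)) by fp.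
  apply: (fp_foldl (h := fun n => hw n + 4) fv F0 F); first by polyb.
  move=> x n; rewrite /=.
  have S (u : seq bool * bool) s : sz (foldl eq_step u s).1 <= sz u.1.
    by elim: s u => //= c s IH u; apply: leq_trans (IH _) _; apply: sz_behead.
  have := S (w x, true) (take n (v x)); have := Hw x.
  case: (foldl _ _ _) => r b /=; rewrite sz_pair; have := sz_bool b; lia.
have G : fp (fun x => nilp (foldl eq_step (w x, true) (v x)).1 &&
                      (foldl eq_step (w x, true) (v x)).2).
  by apply: fp_andb; [apply: fp_nilp|]; fp.
by apply: (eq_fp _ G) => x; rewrite fold_eq_step.
Qed.

Lemma fp_mem_word T {eT : Enc T} (w : T -> word) (l : T -> seq word) :
  fp w -> fp l -> fp (fun x => w x \in l x).
Proof.
move=> fw fl; have F : fp (fun z : T * word => w z.1 == z.2).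
  by apply: fp_eq_word; fp; apply: fp_comp fp_fst fw.
apply: (eq_fp _ (fp_has fl F)) => x /=; rewrite -has_pred1.
by apply: eq_has => y /=; rewrite eq_sym.
Qed.

(** * Functions on finite types *)

Fixpoint tree_eqb (t u : tree) : bool :=
  match t, u with
  | Leaf, Leaf => true
  | Node t1 t2, Node u1 u2 => tree_eqb t1 u1 && tree_eqb t2 u2
  | _, _ => false
  end.

Lemma tree_eqP t u : reflect (t = u) (tree_eqb t u).
Proof.
apply: (iffP idP) => [|<-]; last by elim: t => //= t1 -> t2 ->.
by elim: t u => [|t1 IH1 t2 IH2] [|u1 u2] //= /andP[/IH1-> /IH2->].
Qed.

Lemma fp_tree_eqb c : fp (fun t => tree_eqb t c).
Proof.
pose dest t := if t is Node u v then Some (u, v) else None.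
elim: c => [|c1 IH1 c2 IH2].
  have F : fp (fun t => if dest t is Some uv then (fun=> false) (t, uv) else true).
    by apply: (fp_case (g := fun=> false)) => [[]| | |] //; fp.
  by apply: (eq_fp _ F) => -[].
pose g (z : tree * (tree * tree)) := tree_eqb z.2.1 c1 && tree_eqb z.2.2 c2.
have F : fp (fun t => if dest t is Some uv then g (t, uv) else false).
  apply: (fp_case (g := g)) => [[]| | |] //; fp.
  by apply: fp_andb; [apply: fp_comp IH1 | apply: fp_comp IH2]; fp.
by apply: (eq_fp _ F) => -[].
Qed.

(** The program is a lookup table: one comparison with a constant tree for each element of the type.
    Injectivity of the encoding makes the entry found the right one. *)
Lemma fp_finite (T : finType) U {eT : Enc T} {eU : Enc U} (f : T -> U) :
  injective (enc : T -> tree) -> fp f.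
Proof.
move=> inj.
have fE : fp (enc : T -> tree) by apply: fp_cast.
case: (pickP T) => [x0 _|T0]; last first.
  by exists Skip, 0 => x; have := T0 x.
pose table := foldr (fun c (h : T -> U) x => if tree_eqb (@enc T eT x) (@enc T eT c) then f c else h x)
  (fun=> f x0).
have ft s : fp (table s).
  elim: s => [|c s IH] /=; first by fp.
  apply: fp_if; fp; apply: (fp_comp (f := enc)) (fp_tree_eqb _).
  exact: fE.
apply: (eq_fp _ (ft (enum T))) => x.
have : x \in enum T by rewrite mem_enum.
elim: (enum T) => //= c s IH; rewrite inE.
by case: tree_eqP => [/inj->//|xc /predU1P[xc'|/IH //]]; case: xc; rewrite xc'.
Qed.

Definition enc_fin (T : finType) : Enc T :=
  fun x => enc (nseq (index x (enum T)) tt).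

Lemma enc_fin_inj (T : finType) : injective (@enc_fin T).
Proof.
move=> x y; rewrite /enc_fin.
have nI m n : enc (nseq m tt) = enc (nseq n tt) -> m = n.
  by elim: m n => [|m IH] [|n] //= [] /IH->.
have H z : z \in enum T by rewrite mem_enum.
by move/nI => E; rewrite -(nth_index x (H x)) E nth_index.
Qed.

Lemma enc_prod_inj T U (eT : Enc T) (eU : Enc U) : injective (enc : T -> tree) ->
  injective (enc : U -> tree) -> injective (enc : T * U -> tree).
Proof. by move=> iT iU [x y] [x' y'] [/iT-> /iU->]. Qed.

(** * Simulation of Turing machines *)

Section SimulateTM.
Variable M : TM.
Local Notation Q := (tm_Q M).
Local Notation G := (tm_G M).
Local Instance encQ : Enc Q := @enc_fin Q.
Local Instance encG : Enc G := @enc_fin G.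

Lemma fp_state_fun U {eU : Enc U} (f : Q -> U) : fp f.
Proof. by apply: fp_finite; apply: enc_fin_inj. Qed.

Lemma fp_symbol_fun U {eU : Enc U} (f : G -> U) : fp f.
Proof. by apply: fp_finite; apply: enc_fin_inj. Qed.

Lemma fp_table U {eU : Enc U} (f : Q * G -> U) : fp f.
Proof.
apply: fp_finite; apply: enc_prod_inj; apply: enc_fin_inj.
Qed.

Definition goes_left (m : move) : bool := if m is MLeft then true else false.
Definition goes_right (m : move) : bool := if m is MRight then true else false.

Lemma fp_tm_step : fp (@tm_step M).
Proof.
pose B := tm_blank M.
pose d (z : Q * G) := tm_delta z.1 z.2.
pose s (c : config M) := (c.1.1, head B c.2).
have fs : fp s by rewrite /s; fp; apply: fp_head; fp.
have fd U (eU : Enc U) (f : Q * G * move -> U) : fp (fun c => f (d (s c))).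
  exact: fp_comp fs (fp_table (f \o d)).
have fq : fp (fun c => (d (s c)).1.1) by apply: (fd _ _ (fun z => z.1.1)).
have fg : fp (fun c => (d (s c)).1.2) by apply: (fd _ _ (fun z => z.1.2)).
have fr : fp (fun c : config M => behead c.2) by apply: fp_behead; fp.
have F : fp (fun c : config M => if tm_halt c.1.1 then c else
    if goes_left (d (s c)).2 then
      ((d (s c)).1.1, behead c.1.2, head B c.1.2 :: (d (s c)).1.2 :: behead c.2)
    else if goes_right (d (s c)).2 then
      ((d (s c)).1.1, (d (s c)).1.2 :: c.1.2, behead c.2)
    else ((d (s c)).1.1, c.1.2, (d (s c)).1.2 :: behead c.2)).
  apply: fp_if; [|by fp|apply: fp_if; [| |apply: fp_if]].
  - by apply: fp_comp (fp_state_fun _); fp.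
  - exact: (fd _ _ (fun z => goes_left z.2)).
  - apply: fp_pair; first by apply: fp_pair => //; apply: fp_behead; fp.
    by apply: fp_cons; [apply: fp_head | apply: fp_cons]; fp.
  - exact: (fd _ _ (fun z => goes_right z.2)).
  - by apply: fp_pair => //; apply: fp_pair => //; apply: fp_cons => //; fp.
  - by apply: fp_pair; [apply: fp_pair | apply: fp_cons] => //; fp.
apply: (eq_fp _ F) => -[[q l] r]; rewrite /tm_step /s /d /=.
by case: (tm_halt q) => //; case: (tm_delta _ _) => -[q' b] [].
Qed.

Definition cell_bound : nat := \max_(q : Q) sz q + \max_(g : G) sz g.

Lemma sz_state (q : Q) : sz q <= cell_bound.
Proof. exact: leq_trans (leq_bigmax q) (leq_addr _ _). Qed.

Lemma sz_symbol (g : G) : sz g <= cell_bound.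
Proof. exact: leq_trans (leq_bigmax g) (leq_addl _ _). Qed.

Lemma sz_symbols (l : seq G) : sz l <= 1 + size l * cell_bound.+1.
Proof.
elim: l => //= g l IH; rewrite sz_cons mulSn; have := sz_symbol g; lia.
Qed.

Definition cells (c : config M) : nat := size c.1.2 + size c.2.

Lemma sz_config (c : config M) : sz c <= cell_bound + 4 + cells c * cell_bound.+1.
Proof.
case: c => -[q l] r; rewrite !sz_pair /cells /= mulnDl.
have := sz_state q; have := sz_symbols l; have := sz_symbols r; lia.
Qed.

Lemma cells_step c : cells (tm_step c) <= (cells c).+2.
Proof.
case: c => -[q l] r; rewrite /tm_step /cells; case: tm_halt => /=; first by lia.
by case: (tm_delta _ _) => -[q' b] [] /=; rewrite !size_behead; lia.
Qed.

(** Only the length matters: such a list is the counter over which a fold iterates polynomially many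
    times. *)
Fixpoint power_list (k : nat) (s : seq bool) : seq bool :=
  if k is k'.+1 then flatten [seq s | _ <- power_list k' s] else [:: true].

Lemma size_power_list k s : size (power_list k s) = size s ^ k.
Proof.
elim: k => //= k IH; rewrite size_flatten /shape -map_comp expnS -IH.
by elim: (power_list k s) => [|_ l /= ->]; rewrite ?muln0 ?mulnS.
Qed.

Lemma fp_power_list k : fp (power_list k).
Proof.
elim: k => [|k IH] /=; first by fp.
exact: (fp_flatten_map (g := fun z => z.1)) IH fp_fst.
Qed.

Definition clock (c : nat) (x : word) : seq bool := power_list c.+1 (nseq c.+1 true ++ x).

Lemma fp_clock c : fp (clock c).
Proof.
apply: fp_comp (fp_power_list _); apply: fp_cat; fp; exact: fp_id.
Qed.

Lemma size_clock c x : poly_bound c (size x) <= size (clock c x).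
Proof.
rewrite size_power_list size_cat size_nseq expnS /poly_bound.
case: c => [|c]; first by rewrite mul0n.
have H : size x ^ c.+1 < (c.+2 + size x) ^ c.+1 by rewrite ltn_exp2r //; lia.
(* The bound factors as c * (n^c + 1), and each factor is dominated by one factor of the clock's
   length. *)
rewrite -mulnSr; apply: leq_mul => //; lia.
Qed.

Lemma fp_tm_run c : fp (fun x => tm_run M (size (clock c x)) x).
Proof.
have [h ph Hh] := fp_size (fp_clock c).
pose f (z : word * config M * bool) := tm_step z.1.2.
have ff : fp f by apply: (fp_comp (g := @tm_step M) _ fp_tm_step); fp.
have fi : fp (tm_init M).
  rewrite /tm_init; apply: fp_pair; first by fp.
  by apply: (fp_map (g := fun z => tm_sym M z.2)); [fp|apply: fp_comp fp_snd _; apply: fp_finite; case=> [] []].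
have E x (s : seq bool) u : foldl (fun u y => f (x, u, y)) u s = iter (size s) (@tm_step M) u.
  by elim: s u => //= y s IH u; rewrite IH -iterSr.
have F : fp (fun x => foldl (fun u y => f (x, u, y)) (tm_init M x) (clock c x)); last first.
  by apply: (eq_fp _ F) => x; rewrite E.
apply: (fp_foldl (h := fun n => cell_bound + 4 + (n + 2 * h n) * cell_bound.+1) (fp_clock c) fi ff).
  by polyb.
move=> x n; rewrite E; apply: leq_trans (sz_config _) _.
rewrite leq_add2l leq_mul2r; apply/orP; right.
have S k : cells (iter k (@tm_step M) (tm_init M x)) <= size x + 2 * k.
  elim: k => [|k IH]; first by rewrite /cells /= size_map muln0 addn0.
  by rewrite iterS; apply: leq_trans (cells_step _) _; lia.
apply: leq_trans (S _) _; apply: leq_add; first exact/ltnW/size_sz.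
rewrite leq_mul2l /=; apply: leq_trans (Hh x); apply: leq_trans (ltnW (size_sz _)).
by rewrite size_take_min geq_minr.
Qed.

Lemma fp_read_bits : fp (read_bits (@tm_bit M)).
Proof.
(* A fold cannot stop early, so a flag records whether the prefix of bits is still being read. *)
pose isb (g : G) := isSome (tm_bit g); pose val (g : G) := odflt false (tm_bit g).
pose f (z : seq G * (bool * seq bool) * G) : bool * seq bool :=
  if z.1.2.1 && isb z.2 then (true, val z.2 :: z.1.2.2) else (false, z.1.2.2).
have ff : fp f.
  apply: fp_if; [apply: fp_andb; first by fp| |by fp].
    by apply: fp_comp fp_snd (fp_symbol_fun _).
  by fp; apply: fp_comp fp_snd (fp_symbol_fun _).
have E x s b w : (foldl (fun u y => f (x, u, y)) (b, w) s).2 =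
    catrev (if b then read_bits (@tm_bit M) s else [::]) w.
  elim: s b w => [|g s IH] [] w //=; last by rewrite /f /= IH.
  by rewrite {2}/f /isb /val /=; case: (tm_bit g) => [b|] /=; rewrite IH.
have F : fp (fun l => foldl (fun u y => f (l, u, y)) (true, [::]) l); last first.
  by apply: (eq_fp _ (fp_rev (fp_psnd F))) => x; rewrite E -/(rev _) revK.
apply: (fp_foldl (h := fun n => 5 + 4 * n)) => //; [exact: fp_id|by fp|by polyb|].
move=> x n.
have S s (u : bool * seq bool) : sz (foldl (fun u y => f (x, u, y)) u s).2 <= sz u.2 + 4 * size s.
  elim: s u => [|g s IH] u /=; first by rewrite muln0 addn0.
  apply: leq_trans (IH _) _.
  have H : sz (f (x, u, g)).2 <= sz u.2 + 4; last by lia.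
  rewrite /f; case: ifP => _ /=; last by lia.
  by rewrite sz_cons; have := sz_bool (val g); lia.
have := S (take n x) (true, [::]).
have : size (take n x) <= sz x.
  by apply: leq_trans (ltnW (size_sz _)); rewrite size_take_min geq_minr.
case: (foldl _ _ _) => b w /=; rewrite sz_pair sz_nil; have := sz_bool b; lia.
Qed.
End SimulateTM.

(** A halted configuration is a fixed point of the step function, so a clock that overshoots the
    time bound gives the same result. *)
Lemma tm_run_clock (M : TM) c x : tm_halts_within M (poly_bound c (size x)) x ->
  tm_run M (size (clock c x)) x = tm_run M (poly_bound c (size x)) x.
Proof. by move=> H; apply: tm_run_halted H (size_clock _ _). Qed.

Lemma poly_time_computable_fp f : poly_time_computable f -> fp f.
Proof.
move=> [M [c H]].
have F := fp_comp (fp_comp (fp_tm_run M c) fp_snd) (fp_read_bits M).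
apply: (eq_fp _ F) => x; have [h <-] := H x.
by rewrite tm_run_clock.
Qed.

Lemma in_P_fp L : in_P L -> exists2 d : word -> bool, fp d & forall x, d x <-> L x.
Proof.
move=> [M [c H]].
exists (fun x => tm_acc (tm_run M (size (clock c x)) x).1.1).
  exact: (fp_comp (fp_comp (fp_comp (fp_tm_run M c) fp_fst) fp_fst) (fp_state_fun _)).
by move=> x; have [h <-] := H x; rewrite tm_run_clock.
Qed.

Lemma sz_word (x : seq bool) : sz x <= 1 + 4 * size x.
Proof. by elim: x => //= b x IH; rewrite sz_cons; have := sz_bool b; lia. Qed.

(** Stack B delivers the input from its last bit, so the encoded list is built from its end; the bit
    [false] pushed first is the empty list. Removing the root bit of the answer leaves stack A empty
    exactly for [false], which is the acceptance convention of the machine. *)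
Lemma fp_in_P (d : word -> bool) L : fp d -> (forall x, d x <-> L x) -> in_P L.
Proof.
move=> [p [c Hp]] dL.
pose load := While iB (push_all [:: true; false]) (push_all [:: true; true; false; false]).
have Hload (x y : word) : runs load (St (ser (enc y)) (rev x) [::] [::] [::])
    (rest (ser (enc (x ++ y)))) (5 * size x + 1).
  elim/last_ind: x y => [|x b IH] y; first exact: runs_while_end.
  rewrite cat_rcons size_rcons; apply: runs_le.
    apply: (@runs_while _ _ _ _ _ _ b (rev x) 4 _ _ _ (IH (b :: y))) => /=.
      by rewrite rev_rcons.
    case: b; first exact: (runs_push_all [:: true; true; false; false]).
    exact: (@runs_le _ _ _ 2 _ (runs_push_all [:: true; false] _ _ _ _ _)).
  lia.
apply: (@in_P_prog _ (Seq (Push iA false) (Seq load (Seq p (Pop iA Skip Skip Skip))))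
  (fun n => 1 + (5 * n + 1 + ((1 + 4 * n + 2) ^ c + 1)))); first by polyb.
move=> x.
have [m mle E] : runs (Seq (Push iA false) (Seq load (Seq p (Pop iA Skip Skip Skip))))
    (input_store x) (rest (behead (ser (enc (d x)))))
    (1 + (5 * size x + 1 + ((1 + 4 * size x + 2) ^ c + 1))).
  apply: runs_seq; first exact: runs_push.
  apply: runs_seq; first exact: (Hload x [::]).
  rewrite cats0; apply: runs_seq.
    have := Hp x [::]; rewrite !cats0 => H; apply: runs_le H _.
    by apply: leq_exp_base; rewrite leq_add2r; apply: sz_word.
  by apply: runs_pop; case: (d x) => /=; exists 0 => //; constructor.
exists (rest (behead (ser (enc (d x))))), m; split=> //.
by rewrite -dL; case: (d x).
Qed.

(** * Unit propagation with lookahead *)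

Section Refutation.
Variables (L : eqType) (neg : L -> L).
Implicit Types (F : seq (seq L)) (c al : seq L).

Definition live al c := [seq m <- c | neg m \notin al].

(* If every literal of [c] is already false, all of them are derived; this
   keeps [up_round] monotone. *)
Definition forced al c := [seq m <- c | all (pred1 m) (live al c)].

(** Derived literals are added to [al0] and not to [al], which keeps every round within the size of
    [F] and [al0]. By monotonicity the iterates from [al0] still increase. *)
Definition up_round F al0 al := flatten [seq forced al c | c <- F] ++ al0.

Definition conflict F al := has (fun c => nilp (live al c)) F.

(** The number of rounds is the fuel of [unit_prop] on [F], which is enough for every restriction of
    [F]. *)
Definition refute F al := conflict F (iter (size F).+1 (up_round F al) al).

Fixpoint refute_k k F al : bool :=
  if k is k'.+1 then
    refute_k k' F al ||
    has (fun l => refute_k k' F (l :: al) && refute_k k' F (neg l :: al)) (flatten F)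
  else refute F al.

Lemma live_mono al bl c : {subset al <= bl} -> {subset live bl c <= live al c}.
Proof.
move=> ab m; rewrite !mem_filter => /andP[mb ->]; rewrite andbT.
by apply: contra mb; apply: ab.
Qed.

Lemma conflict_mono F al bl : {subset al <= bl} -> conflict F al -> conflict F bl.
Proof.
move=> ab /hasP[c cF c0]; apply/hasP; exists c => //.
move: c0; case E: (live al c) => //= _.
case E': (live bl c) => [//|m s]; have := live_mono ab (c := c) (x := m).
by rewrite E' E inE eqxx => /(_ isT).
Qed.

Lemma mem_up_round F al0 al m :
  reflect (m \in al0 \/ exists2 c, c \in F & (m \in c) && all (pred1 m) (live al c))
    (m \in up_round F al0 al).
Proof.
rewrite mem_cat orbC; apply: (iffP orP) => -[]; try by left.
  case/flatten_mapP=> c cF; rewrite mem_filter => /andP[a b].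
  by right; exists c => //; rewrite b.
move=> [c cF /andP[mc a]]; right; apply/flatten_mapP; exists c => //.
by rewrite mem_filter a.
Qed.

Lemma up_round_mono F al0 al bl : {subset al <= bl} ->
  {subset up_round F al0 al <= up_round F al0 bl}.
Proof.
move=> ab m /mem_up_round H; apply/mem_up_round; case: H; first by left.
move=> [c cF /andP[mc /allP a]]; right; exists c => //; rewrite mc.
by apply/allP=> y /(live_mono ab); apply: a.
Qed.

Lemma iter_up_round_sub F al n :
  {subset iter n (up_round F al) al <= iter n.+1 (up_round F al) al}.
Proof.
elim: n => [|n IH]; first by move=> m mal; apply/mem_up_round; left.
exact: up_round_mono.
Qed.
End Refutation.

(** * Invariance of refutation under renaming of literals *)

Section Rename.
Variables (L L' : eqType) (neg : L -> L) (neg' : L' -> L') (f : L -> L').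
Hypothesis f_inj : injective f.
Hypothesis f_neg : forall l, f (neg l) = neg' (f l).
Local Notation mf := (map f).

Lemma live_map al c : live neg' (mf al) (mf c) = mf (live neg al c).
Proof.
rewrite /live filter_map; congr map; apply: eq_filter => m /=.
by rewrite -f_neg mem_map.
Qed.

Lemma conflict_map F al : conflict neg' (map mf F) (mf al) = conflict neg F al.
Proof.
rewrite /conflict has_map; apply: eq_has => c /=.
by rewrite live_map /nilp size_map.
Qed.

Lemma up_round_map F al0 al :
  up_round neg' (map mf F) (mf al0) (mf al) = mf (up_round neg F al0 al).
Proof.
rewrite /up_round map_cat map_flatten -!map_comp; congr (flatten _ ++ _).
apply: eq_map => c /=; rewrite /forced live_map filter_map; congr map.
apply: eq_filter => m /=; rewrite all_map; apply: eq_all => y /=.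
exact: inj_eq.
Qed.

Lemma refute_map F al : refute neg' (map mf F) (mf al) = refute neg F al.
Proof.
rewrite /refute size_map -conflict_map; congr conflict.
by elim: (size F).+1 => //= n ->; rewrite up_round_map.
Qed.

Lemma refute_k_map k F al : refute_k neg' k (map mf F) (mf al) = refute_k neg k F al.
Proof.
elim: k al => [|k IH] al /=; first exact: refute_map.
rewrite IH -map_flatten has_map; congr (_ || _); apply: eq_has => l /=.
by rewrite -f_neg -IH -(IH (_ :: _)).
Qed.
End Rename.

Definition negl (l : lit) : lit := (l.1, ~~ l.2).

Lemma neglK : involutive negl. Proof. by case=> v b; rewrite /negl negbK. Qed.

Lemma lit_true_negl a l : lit_true a (negl l) = ~~ lit_true a l.
Proof. by rewrite /lit_true /=; case: (a _); case: l.2. Qed.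

(** * Soundness of refutation *)

Section Soundness.
Variables (a : nat -> bool) (F : cnf).
Hypothesis aF : satisfies a F.

Lemma live_true al c : c \in F -> all (lit_true a) al ->
  exists2 m, m \in live negl al c & lit_true a m.
Proof.
move=> cF /allP ala; have /hasP[m mc ma] := allP aF c cF.
exists m => //; rewrite mem_filter mc andbT.
by apply/negP => /ala; rewrite lit_true_negl ma.
Qed.

Lemma up_round_true al0 al : all (lit_true a) al0 -> all (lit_true a) al ->
  all (lit_true a) (up_round negl F al0 al).
Proof.
move=> /allP al0a ala; apply/allP=> m /mem_up_round[/al0a//|[c cF /andP[_ /allP H]]].
(* A true clause always keeps a live true literal; if all its live literals equal [m], then [m] is
   that literal. *)
by have [y /H/eqP<-] := live_true cF ala.
Qed.

Lemma refute_sound al : all (lit_true a) al -> ~~ refute negl F al.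
Proof.
move=> ala; apply/hasPn => c cF.
have H : all (lit_true a) (iter (size F).+1 (up_round negl F al) al).
  by elim: (_.+1) => // n IH; rewrite iterS up_round_true.
by have [m] := live_true cF H; case: live.
Qed.

Lemma refute_k_sound k al : all (lit_true a) al -> ~~ refute_k negl k F al.
Proof.
elim: k al => [|k IH] al ala /=; first exact: refute_sound.
rewrite negb_or IH //=; apply/hasPn => l _; apply/negP => /andP[H1 H2].
case E: (lit_true a l).
  by move: (IH (l :: al)); rewrite /= E ala H1 => /(_ isT).
by move: (IH (negl l :: al)); rewrite /= lit_true_negl E ala H2 => /(_ isT).
Qed.
End Soundness.

(** Clauses of the rewritten formula lie between a clause of [F] and its live part. Inclusions are
    needed because parallel rounds may derive more than the sequential loop, so a clause of [G] may
    keep literals already false under [al]; clauses removed as satisfied simply have no counterpart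
    in [G]. *)
Definition covers (F : cnf) (al : seq lit) (G : cnf) : Prop :=
  forall c', c' \in G -> exists2 c, c \in F &
    {subset c' <= c} /\ {subset live negl al c <= c'}.

Lemma least_unit_mem G l : least_unit G = Some l -> l \in unit_lits G.
Proof.
rewrite /least_unit; elim: (unit_lits G) l => //= l' s IH l.
case: (foldr _ _ _) IH => [m|] IH; last by case=> ->; rewrite inE eqxx.
case: ifP => _ [<-]; rewrite inE ?eqxx //.
by rewrite IH // orbT.
Qed.

Lemma unit_lits_mem G l : l \in unit_lits G ->
  exists2 c, c \in G & (l \in c) && all (pred1 l) c.
Proof.
case/mapP=> c; rewrite mem_filter => /andP[c1 cG] ->; exists c => //.
case: c c1 {cG} => [//|m s] c1; rewrite /= inE eqxx /=.
have /eqP := c1; case E: (undup _) => [|y [|]] // _.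
have H z : z \in m :: s -> z = y by rewrite -mem_undup E inE => /eqP.
have -> : m = y by apply: H; rewrite inE eqxx.
by apply/allP=> z zs; apply/eqP/H; rewrite inE zs orbT.
Qed.

(** Each iteration of the loop is matched by one more round. The empty clause reached at the end
    covers a clause of [F] without live literals, which is a conflict. *)
Lemma up_unsat_conflict F al0 n i G acc :
  covers F (iter i (up_round negl F al0) al0) G ->
  up_loop n G acc = UP_unsat ->
  conflict negl F (iter (i + n) (up_round negl F al0) al0).
Proof.
set al := fun i => iter i (up_round negl F al0) al0.
have mono j d : {subset al j <= al (j + d)}.
  elim: d => [|d IH] m; rewrite ?addn0 // => /IH; rewrite addnS.
  exact: iter_up_round_sub.
rewrite -!/(al _); elim: n i G acc => [|n IH] i G acc cov /=.
all: case: ifP => // _; case: ifP => [/cov[c cF [_ sub]] _|_ //].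
1,2: apply: (conflict_mono (mono i _)); apply/hasP; exists c => //.
1,2: by case: live sub => // m s /(_ m); rewrite inE eqxx => /(_ isT).
case E: least_unit => [l|//] U.
have [c' c'G /andP[lc' /allP c'l]] := unit_lits_mem (least_unit_mem E).
have [c cF [c'c cc']] := cov _ c'G.
(* The live part of [c] contains at most [l]. If it is empty, [forced] yields every literal of [c],
   hence [l] as well. *)
have lal : l \in al i.+1.
  apply/mem_up_round; right; exists c => //; rewrite c'c //.
  by apply/allP=> m /cc' /c'l.
rewrite addnS -addSn; apply: IH U => d' /mapP[e]; rewrite mem_filter => /andP[_ eG] ->.
have [d dF [ed de]] := cov _ eG; exists d => //; split=> m.
  by rewrite mem_filter => /andP[_ /ed].
move=> mlive; rewrite mem_filter.
(* The loop deletes only the negation of [l], and that literal is not live once [l] is derived. *)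
have -> : m \in e by apply: de; apply: live_mono mlive; apply: iter_up_round_sub.
rewrite andbT; apply/eqP => ml; move: mlive; rewrite mem_filter ml.
by rewrite -[(l.1, _)]/(negl l) neglK => /andP[/negP[]].
Qed.

Lemma restrict_covers F S a al : (forall v, v \in S -> (v, a v) \in al) ->
  covers F al (restrict F S a).
Proof.
move=> Sal c' /mapP[c]; rewrite mem_filter => /andP[_ cF] ->; exists c => //.
split=> m; first by rewrite mem_filter => /andP[].
rewrite !mem_filter => /andP[mal ->]; rewrite andbT.
apply: contra mal => /andP[/Sal]; rewrite /lit_true /negl.
by case: m => v b /=; case: (a v); case: b.
Qed.

Lemma unit_prop_unsat_refute F S a al : (forall v, v \in S -> (v, a v) \in al) ->
  unit_prop (restrict F S a) = UP_unsat -> refute negl F al.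
Proof.
move=> Sal U.
have := up_unsat_conflict (i := 0) (al0 := al) (restrict_covers (F := F) Sal) U.
rewrite add0n; apply: conflict_mono.
have : (size (restrict F S a)).+1 <= (size F).+1.
  by rewrite ltnS size_map size_filter count_size.
move=> /subnKC <-; elim: (_ - _) => [|d IH] m; rewrite ?addn0 // => /IH.
rewrite addnS; exact: iter_up_round_sub.
Qed.

Lemma psat_restrict_satisfiable F S a s : psat s (restrict F S a) -> satisfiable F.
Proof.
move=> [cons /allP sG].
(* Variables left open by both [a] on [S] and [s] become false; consistency of [s] makes its
   negative literals true. *)
exists (fun v => if v \in S then a v else (v, true) \in s).
apply/allP=> c cF; case: (boolP (has (fun m => (m.1 \in S) && lit_true a m) c)).
  case/hasP=> m mc /andP[mS ma]; apply/hasP; exists m => //.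
  by rewrite /lit_true mS.
move=> nh; have cG : [seq m <- c | ~~ ((m.1 \in S) && ~~ lit_true a m)] \in restrict F S a.
  by apply: map_f; rewrite mem_filter nh.
have /hasP[l] := sG _ cG; rewrite mem_filter => /andP[la lc] ls.
apply/hasP; exists l => //; rewrite /lit_true.
case: ifP la => [lS /=|_ _]; first by rewrite negbK.
case: l lc ls => v [] _ /= ls; first by rewrite ls.
by case: (boolP (_ \in s)) => // vt; case: (cons v).
Qed.

Lemma refute_kW k F al : refute negl F al -> refute_k negl k F al.
Proof. by elim: k => //= k IH /IH->. Qed.

(** If branching on a literal does not refute, one of its two values survives with one level of
    lookahead less. Fixing the variables of [V] in turn in this way uses at most [k] levels. *)
Lemma not_refute_k_assignment k F V al : uniq V -> size V <= k ->
  {subset V <= vars F} -> ~~ refute_k negl k F al ->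
  exists a al', [/\ ~~ refute negl F al', {subset al <= al'} &
    forall v, v \in V -> (v, a v) \in al'].
Proof.
elim: V k al => [|v V IH] k al /=.
  move=> _ _ _ H; exists xpredT, al; split=> //.
  by apply: contra H; apply: refute_kW.
case/andP=> vV uV; case: k => // k Vk VF /=; rewrite negb_or => /andP[_ /hasPn H].
have /flattenP[c /mapP[c' c'F ->] /mapP[l lc' vl]] : v \in vars F by apply: VF; rewrite inE eqxx.
have lF : l \in flatten F by apply/flattenP; exists c'.
have [b Hb] : exists b, ~~ refute_k negl k F ((v, b) :: al).
  have := H l lF; rewrite negb_and => /orP[] H'.
    by exists l.2; rewrite vl; case: (l) H'.
  by exists (~~ l.2); rewrite vl.
have [|a [al' [H1 H2 H3]]] := IH k _ uV Vk _ Hb.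
  by move=> w wV; apply: VF; rewrite inE wV orbT.
exists (fun w => if w == v then b else a w), al'; split=> // [m mal|w].
  by apply: H2; rewrite inE mal orbT.
rewrite inE; case: eqVneq => [->|_] /=; last exact: H3.
by move=> _; apply: H2; rewrite inE eqxx.
Qed.

(** * Lookahead decides formulas with small backdoors *)

Lemma backdoor_satisfiable k F S : strong_backdoor_UP F S -> card_vars S <= k ->
  ~~ refute_k negl k F [::] -> satisfiable F.
Proof.
move=> [_ [SF det]] Sk H.
have [|a [al [nr _ Sal]]] := not_refute_k_assignment (undup_uniq S) Sk _ H.
  by move=> v; rewrite mem_undup => /SF.
have {}Sal v : v \in S -> (v, a v) \in al by rewrite -mem_undup => /Sal.
have := det a; rewrite /up_determines; case U: unit_prop => [s| |] //.
  exact: psat_restrict_satisfiable.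
by case/negP: nr; apply: unit_prop_unsat_refute Sal U.
Qed.

Lemma backdoor_refute_k k F S : strong_backdoor_UP F S -> card_vars S <= k ->
  satisfiable F <-> ~~ refute_k negl k F [::].
Proof.
move=> bS Sk; split; last exact: backdoor_satisfiable bS Sk.
by move=> [a aF]; apply: refute_k_sound aF _ _ _.
Qed.

(** * The lookahead procedure on encodings *)

(** These are the digits that [encode_lit] writes before the end mark, so parsing never computes a
    number, and negation flips the first bit. *)
Definition lit_word (l : lit) : seq bool := l.2 :: bin l.1.
Definition neg_word (w : seq bool) : seq bool := ~~ head false w :: behead w.
Definition cnf_words (F : cnf) : seq (seq (seq bool)) := map (map lit_word) F.

Lemma bin_inj : injective bin.
Proof.
pose value := foldr (fun (b : bool) m => b + m.*2) 0.
have H k n : n <= k -> value (bin_aux k n) = n.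
  elim: k n => [|k IH] n /=; first by rewrite leqn0 => /eqP->.
  move=> nk; case: eqP => [->//|n0] /=; rewrite IH ?odd_double_half //.
  by have := odd_double_half n; lia.
by move=> m n E; rewrite -(H m m) // -(H n n) // -/(bin m) E.
Qed.

Lemma lit_word_inj : injective lit_word.
Proof. by move=> [v b] [w c] [-> /bin_inj->]. Qed.

Lemma lit_word_neg l : lit_word (negl l) = neg_word (lit_word l).
Proof. by []. Qed.

(** The word is read from the right: an end mark then comes before what it closes and opens an empty
    clause or literal, to which digits are added at the front. *)
Definition add_token (b b' : bool) (F : seq (seq (seq bool))) : seq (seq (seq bool)) :=
  let c := head [::] F in
  if b then if b' then [::] :: F else ([::] :: c) :: behead F
  else ((b' :: head [::] c) :: behead c) :: behead F.

Definition parse_step (b : bool) (u : seq bool * seq (seq (seq bool))) :=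
  if u.1 is b' :: _ then ([::], add_token b b' u.2) else ([:: b], u.2).

Definition parse (x : seq bool) : seq (seq (seq bool)) := (foldr parse_step ([::], [::]) x).2.

Lemma parse_digits w v c F :
  foldr parse_step ([::], (v :: c) :: F) (flatten (map tok_digit w)) =
  ([::], ((w ++ v) :: c) :: F).
Proof. by elim: w => //= b w ->. Qed.

Lemma parse_lit l c F :
  foldr parse_step ([::], c :: F) (encode_lit l) = ([::], (lit_word l :: c) :: F).
Proof.
by rewrite /encode_lit !foldr_cat /= parse_digits cats0.
Qed.

Lemma parse_clause c F :
  foldr parse_step ([::], F) (encode_clause c) = ([::], map lit_word c :: F).
Proof.
rewrite /encode_clause foldr_cat /=.
elim: c => [//|l c IH].
by rewrite -[flatten _]/(encode_lit l ++ flatten (map encode_lit c)) foldr_cat IH parse_lit.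
Qed.

Lemma parse_encode F : parse (encode_cnf F) = cnf_words F.
Proof.
rewrite /parse /encode_cnf.
suff -> : foldr parse_step ([::], [::]) (flatten (map encode_clause F)) = ([::], cnf_words F) by [].
elim: F => [//|c F IH].
rewrite -[flatten _]/(encode_clause c ++ flatten (map encode_clause F)).
by rewrite foldr_cat IH parse_clause.
Qed.

Lemma encode_cnf_inj : injective encode_cnf.
Proof.
move=> F G /(congr1 parse); rewrite !parse_encode.
by apply: inj_map; apply: inj_map; apply: lit_word_inj.
Qed.

Lemma fp_add_token T {eT : Enc T} (b b' : T -> bool) (F : T -> seq (seq (seq bool))) :
  fp b -> fp b' -> fp F -> fp (fun x => add_token (b x) (b' x) (F x)).
Proof.
move=> fb fb' fF.
have fh : fp (fun x => head [::] (F x)) by apply: fp_head.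
have ft : fp (fun x => behead (F x)) by apply: fp_behead.
apply: fp_if => //; first by apply: fp_if => //; fp.
apply: fp_cons => //; apply: fp_cons; last exact: fp_behead.
by apply: fp_cons => //; apply: fp_head.
Qed.

Lemma sz_add_token b b' F : sz (add_token b b' F) <= sz F + 20.
Proof.
have := sz_bool b'; rewrite /add_token.
by case: b; [case: b' => _|]; case: F => [|[|w c] F] /=; rewrite ?sz_cons ?sz_nil; lia.
Qed.

Lemma fp_parse : fp parse.
Proof.
pose f (z : (seq bool) * (seq bool * seq (seq (seq bool))) * bool) := parse_step z.2 z.1.2.
have ff : fp f.
  pose g (z : (seq bool) * (seq bool * seq (seq (seq bool))) * bool * (bool * seq bool)) :
    seq bool * seq (seq (seq bool)) := ([::], add_token z.1.2 z.2.1 z.1.1.2.2).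
  have fg : fp g by apply: fp_pair; [fp | apply: fp_add_token; fp].
  pose l (z : (seq bool) * (seq bool * seq (seq (seq bool))) * bool) := z.1.2.1.
  have fl : fp l by rewrite /l; fp.
  have f0 : fp (fun z : (seq bool) * (seq bool * seq (seq (seq bool))) * bool =>
     ([:: z.2], z.1.2.2)) by fp.
  apply: (eq_fp _ (fp_seq_case fl f0 fg)) => -[[x [h F]] b].
  by rewrite /f /parse_step /l /=; case: h.
have F : fp (fun x => foldl (fun u b => f (x, u, b)) ([::], [::]) (rev x)); last first.
  by apply: (eq_fp _ (fp_psnd F)) => x; rewrite foldl_rev.
apply: (fp_foldl (h := fun n => 10 + 20 * n)) => //.
- by apply: fp_rev; apply: fp_id.
- by fp.
- by polyb.
move=> x n; set s := take n _.
have S (t : seq bool) : size (foldl (fun u b => f (x, u, b)) ([::], [::]) t).1 <= 1 /\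
    sz (foldl (fun u b => f (x, u, b)) ([::], [::]) t).2 <= 1 + 20 * size t.
  elim/last_ind: t => [|t b]; first by [].
  rewrite -cats1 foldl_cat size_cat /=.
  case: (foldl _ _ t) => h G /= [h1 hG]; rewrite /f /parse_step /=.
  case: h h1 => [|b' h] h1 /=; first by lia.
  by have := sz_add_token b b' G; lia.
have [] := S s; case: (foldl _ _ s) => h G /= h1 hG; rewrite sz_pair.
have := sz_word h; have ss : size s <= sz x.
  apply: leq_trans (ltnW (size_sz _)).
  by rewrite /s size_take_min size_rev geq_minr.
lia.
Qed.

Lemma fp_neg_word T {eT : Enc T} (w : T -> seq bool) : fp w -> fp (fun x => neg_word (w x)).
Proof.
move=> fw; apply: fp_cons; last exact: fp_behead.
by apply: fp_negb; apply: fp_head.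
Qed.

Lemma fp_live T {eT : Enc T} (al c : T -> seq (seq bool)) : fp al -> fp c ->
  fp (fun x => live neg_word (al x) (c x)).
Proof.
move=> fal fc; apply: (fp_filter (b := fun z => neg_word z.2 \notin al z.1)) => //.
apply: fp_negb; apply: fp_mem_word; last exact: fp_comp fp_fst fal.
by apply: fp_neg_word; fp.
Qed.

Lemma fp_forced T {eT : Enc T} (al c : T -> seq (seq bool)) : fp al -> fp c ->
  fp (fun x => forced neg_word (al x) (c x)).
Proof.
move=> fal fc.
apply: (fp_filter (b := fun z => all (pred1 z.2) (live neg_word (al z.1) (c z.1)))) => //.
apply: (fp_all (b := fun u : T * (seq bool) * (seq bool) => u.2 == u.1.2)).
  by apply: fp_live; [apply: fp_comp fp_fst fal | apply: fp_comp fp_fst fc].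
by apply: fp_eq_word; fp.
Qed.

Lemma fp_conflict T {eT : Enc T} (F : T -> seq (seq (seq bool))) (al : T -> seq (seq bool)) :
  fp F -> fp al -> fp (fun x => conflict neg_word (F x) (al x)).
Proof.
move=> fF fal; apply: (fp_has (b := fun z => nilp (live neg_word (al z.1) z.2))) => //.
by apply: fp_nilp; apply: fp_live; [apply: fp_comp fp_fst fal | fp].
Qed.

Lemma sz_cat Y {eY : Enc Y} (s t : seq Y) : (sz (s ++ t)).+1 = sz s + sz t.
Proof. by elim: s => //= y s IH; rewrite !sz_cons; lia. Qed.

Lemma sz_filter Y {eY : Enc Y} (p : pred Y) (s : seq Y) : sz (filter p s) <= sz s.
Proof. by elim: s => //= y s IH; case: (p y); rewrite !sz_cons; lia. Qed.

Lemma sz_up_round (Y : eqType) {eY : Enc Y} (neg : Y -> Y) (F : seq (seq Y)) (al0 al : seq Y) :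
  sz (up_round neg F al0 al) <= sz F + sz al0.
Proof.
have H : sz (flatten [seq forced neg al c | c <- F]) <= sz F.
  elim: F => //= c F IH; rewrite sz_cons.
  have := sz_cat (eY := eY) (forced neg al c) (flatten [seq forced neg al c | c <- F]).
  have : sz (forced neg al c) <= sz c by apply: sz_filter.
  by lia.
have := sz_cat (eY := eY) (flatten [seq forced neg al c | c <- F]) al0.
by rewrite /up_round; lia.
Qed.

Lemma fp_refute : fp (fun z : seq (seq (seq bool)) * seq (seq bool) => refute neg_word z.1 z.2).
Proof.
pose f (z : (seq (seq (seq bool)) * seq (seq bool)) * seq (seq bool) * seq (seq bool)) :=
  up_round neg_word z.1.1.1 z.1.1.2 z.1.2.
have ff : fp f.
  apply: fp_cat; last by fp.
  by apply: (fp_flatten_map (g := fun z => forced neg_word z.1.1.2 z.2)); fp; apply: fp_forced; fp.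
have E z s u : foldl (fun u y => f (z, u, y)) u s = iter (size s) (up_round neg_word z.1 z.2) u.
  by elim: s u => //= y s IH u; rewrite IH -iterSr.
(* The list [[::] :: z.1] serves only as a counter of length [(size z.1).+1], the number of rounds
   in [refute]. *)
have F : fp (fun z : seq (seq (seq bool)) * seq (seq bool) =>
    foldl (fun u y => f (z, u, y)) z.2 ([::] :: z.1)).
  apply: (fp_foldl (h := fun n => n) _ _ ff); [by fp | by fp | by polyb|].
  move=> [G al] n; rewrite E sz_pair /=.
  case: (size _) => [|m]; first exact/leqW/leq_addl.
  by rewrite iterS; apply: leq_trans (sz_up_round _ _ _ _) (leqnSn _).
have C := fp_conflict (fp_fst (U := seq (seq bool))) F.
by apply: (eq_fp _ C) => z; rewrite E.
Qed.

Lemma fp_refute_k k :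
  fp (fun z : seq (seq (seq bool)) * seq (seq bool) => refute_k neg_word k z.1 z.2).
Proof.
elim: k => [|k IH]; first exact: fp_refute.
have ff : fp (fun z : seq (seq (seq bool)) * seq (seq bool) => flatten z.1).
  have F : fp (fun z : seq (seq (seq bool)) * seq (seq bool) =>
      flatten [seq (z, c).2 | c <- z.1]).
    by apply: (fp_flatten_map (g := fun u => u.2)); fp.
  by apply: (eq_fp _ F) => z /=; rewrite map_id.
apply: fp_orb => //.
apply: (fp_has (b := fun u : seq (seq (seq bool)) * seq (seq bool) * seq bool =>
  refute_k neg_word k u.1.1 (u.2 :: u.1.2) &&
  refute_k neg_word k u.1.1 (neg_word u.2 :: u.1.2))) => //.
have fn : fp (fun u : seq (seq (seq bool)) * seq (seq bool) * seq bool => neg_word u.2).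
  by apply: fp_neg_word; fp.
apply: fp_andb.
  by apply: (fp_comp (f := fun u => (u.1.1, u.2 :: u.1.2)) _ IH); fp.
by apply: (fp_comp (f := fun u => (u.1.1, neg_word u.2 :: u.1.2)) _ IH); fp.
Qed.

Definition unrefuted (k : nat) (x : word) : bool := ~~ refute_k neg_word k (parse x) [::].

Lemma fp_unrefuted k : fp (unrefuted k).
Proof.
apply: fp_negb; apply: (fp_comp (f := fun x => (parse x, [::])) _ (fp_refute_k k)).
by apply: fp_pair; [apply: fp_parse | fp].
Qed.

Lemma unrefuted_encode k F S : strong_backdoor_UP F S -> card_vars S <= k ->
  unrefuted k (encode_cnf F) <-> SAT (encode_cnf F).
Proof.
move=> bS Sk; rewrite /unrefuted parse_encode.
rewrite (refute_k_map lit_word_inj lit_word_neg k F [::]).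
rewrite -(backdoor_refute_k bS Sk); split=> [sF|[G [/encode_cnf_inj <-]]] //.
by exists F.
Qed.

(* Only the certificate [[::]] is ever needed, so the verifier may ignore what
   follows the separator. *)
Definition unpair_step (u : bool * seq bool) (b : bool) : bool * seq bool :=
  (~~ u.1, if u.1 then b :: u.2 else u.2).
Definition unpair (y : word) : word := rev (behead (foldl unpair_step (true, [::]) y).2).

Lemma unpair_pair x : unpair (pair_word x [::]) = x.
Proof.
(* Every second bit is kept: the bits of [x], then the [false] of the separator, which lies on top
   of the reversed accumulator and is dropped. *)
suff E w : foldl unpair_step (true, w) (flatten [seq [:: b; b] | b <- x]) = (true, catrev x w).
  by rewrite /unpair /pair_word foldl_cat E /= revK.
by elim: x w => //= b x IH w; rewrite IH.
Qed.

Lemma fp_unpair : fp unpair.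
Proof.
apply: fp_rev; apply: fp_behead; apply: fp_psnd.
apply: (fp_foldl (f := fun z : word * (bool * seq bool) * bool => unpair_step z.1.2 z.2)
  (h := fun n => 5 + 4 * n)); [exact: fp_id|by fp| |by polyb|].
  apply: fp_pair; first by apply: fp_negb; fp.
  by apply: fp_if; fp.
move=> x n; rewrite /=.
have S s (u : bool * seq bool) : sz (foldl unpair_step u s).2 <= sz u.2 + 4 * size s.
  elim: s u => [|b s IH] [[] w] /=; rewrite ?muln0 ?addn0 //; apply: leq_trans (IH _) _ => /=; last by lia.
  by rewrite sz_cons; have := sz_bool b; lia.
have := S (take n x) (true, [::]).
have : size (take n x) <= sz x.
  by apply: leq_trans (ltnW (size_sz _)); rewrite size_take_min geq_minr.
case: (foldl _ _ _) => b w /=; rewrite sz_pair sz_nil; have := sz_bool b; lia.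
Qed.

Lemma in_P_in_NP L : in_P L -> in_NP L.
Proof.
(* With constant 0 the certificate bound is 0, so the only admissible certificate is the empty
   word. *)
move=> /in_P_fp[d fd dL]; exists (fun y => L (unpair y)), 0; split.
  exact: fp_in_P (fp_comp fp_unpair fd) (fun y => dL (unpair y)).
move=> x; split=> [Lx|[w []]]; first by exists [::]; rewrite unpair_pair.
by rewrite /poly_bound mul0n leqn0 => /nilP->; rewrite unpair_pair.
Qed.

Theorem theorem2 :
  forall (k : nat) (A : language),
    0 < k ->
    (* A is a set of (encoded) Boolean formulas *)
    (forall x, A x -> exists F : cnf, x = encode_cnf F) ->
    (* (a) *)
    in_P A ->
    NP_complete (fun x => A x /\ SAT x) ->
    (* (b) *)
    (forall F : cnf, A (encode_cnf F) ->
       exists S : seq nat, strong_backdoor_UP F S /\ card_vars S <= k) ->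
    (* (c) *)
    (exists (M : TM) (c : nat), forall F : cnf, A (encode_cnf F) ->
       tm_halts_within M (poly_bound c (size (encode_cnf F))) (encode_cnf F) /\
       exists S : seq nat,
         tm_output (tm_run M (poly_bound c (size (encode_cnf F))) (encode_cnf F))
           = encode_vars S /\
         strong_backdoor_UP F S /\ card_vars S <= k) ->
    P_eq_NP.
Proof.
move=> k A _ Aenc PA [_ hard] back _ L; split; first exact: in_P_in_NP.
move=> /hard[f [/poly_time_computable_fp ff Lf]].
have [d fd dA] := in_P_fp PA.
(* Lookahead agrees with satisfiability only on [A], hence membership of [f x] in [A] is tested
   alongside. *)
apply: (fp_in_P (d := fun x => d (f x) && unrefuted k (f x))).
  by apply: fp_andb; [apply: fp_comp ff fd | apply: fp_comp ff (fp_unrefuted k)].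
move=> x; rewrite Lf.
have AS y : A y -> unrefuted k y <-> SAT y.
  move=> Ay; have [F yF] := Aenc y Ay; rewrite yF in Ay *.
  by have [S [bS Sk]] := back F Ay; apply: unrefuted_encode bS Sk.
split=> [/andP[/dA Afx /(AS _ Afx)]//|[Afx Sfx]].
by apply/andP; split; [apply/dA | apply/(AS _ Afx)].
Qed.
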